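(* Let $H=\{H_\alpha\}_{\alpha\in G}$ be a Hopf $G$-coalgebra with bijective antipode, $A=\{A_\alpha\}_{\alpha\in G}$ a right $H$-comodule Poisson algebra, and $B=A^{AcoH}$. Let $M$ be a Poisson $(A,H)$-Hopf module, and $\phi:H\rightarrow A^A$ a right $H$-colinear algebra map. Suppose $M^{coH}$ and $A^{coH}$ are trivial Lie $A_e$-modules under $\diamond'$. Then the functor $F_1=(-)^{AcoH}:{}_{\mathcal{P}A}\mathcal{M}^H\rightarrow {}_B\mathcal{M}^{H_0}$ is dual Maschke, that is, every object of ${}_{\mathcal{P}A}\mathcal{M}^H$ is $F_1$-relative projective.
   Context: $k$ is a field; all vector spaces, tensor products and maps are over $k$. $G$ is an abelian group with unit $e$. Hopf $G$-coalgebra: a family $H=\{H_\alpha\}_{\alpha\in G}$ of algebras with algebra maps $\Delta_{\alpha,\beta}:H_{\alpha\beta}\to H_\alpha\otimes H_\beta$ and $\varepsilon:H_e\to k$ such that $(\Delta_{\alpha,\beta}\otimes id)\Delta_{\alpha\beta,\gamma}=(id\otimes\Delta_{\beta,\gamma})\Delta_{\alpha,\beta\gamma}$ and $(id\otimes\varepsilon)\Delta_{\alpha,e}=id=(\varepsilon\otimes id)\Delta_{e,\alpha}$, together with linear maps (the antipode) $S_\alpha:H_\alpha\to H_{\alpha^{-1}}$ with $m_\alpha(S_{\alpha^{-1}}\otimes id)\Delta_{\alpha^{-1},\alpha}=\varepsilon 1_\alpha=m_\alpha(id\otimes S_{\alpha^{-1}})\Delta_{\alpha,\alpha^{-1}}$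 on $H_e$, where $m_\alpha$ is the multiplication and $1_\alpha=1_{H_\alpha}$ the unit of $H_\alpha$. The antipode is bijective if every $S_\alpha$ is bijective. Right $H$-comodule: a family $M=\{M_\alpha\}_{\alpha\in G}$ of vector spaces with linear maps $\rho_{\alpha,\beta}:M_{\alpha\beta}\to M_\alpha\otimes H_\beta$, written $\rho_{\alpha,\beta}(m)=m_{(0,\alpha)}\otimes m_{(1,\beta)}$, such that $(id\otimes\Delta_{\beta,\gamma})\rho_{\alpha,\beta\gamma}=(\rho_{\alpha,\beta}\otimes id)\rho_{\alpha\beta,\gamma}$ and $(id\otimes\varepsilon)\rho_{\alpha,e}=id$. A morphism of families is a family of linear maps $f_\alpha:M_\alpha\to N_\alpha$; it is $H$-colinear if $\rho_{\alpha,\beta}f_{\alpha\beta}=(f_\alpha\otimes id)\rho_{\alpha,\beta}$. $H$ is a right $H$-comodule via $\Delta$. Right $H$-comodule Poisson algebra: a family $A=\{A_\alpha\}$ of (commutative) Poisson algebras which is a right $H$-comodule such that each $\rho_{\alpha,\beta}:A_{\alpha\beta}\to A_\alpha\otimes H_\beta$ is an algebra map and $\rho_{\alpha,\beta}(\{a,b\})=\{a_{(0,\alpha)},b_{(0,\alpha)}\}\otimes a_{(1,\beta)}b_{(1,\beta)}$ for $a,b\in A_{\alpha\beta}$. Poisson $(A,H)$-Hopf module: a right $H$-comodule $M$ such that each $M_\alpha$ is an $A_\alpha$-module (action $a\cdot m$) and a Lie module over the Lie algebra $(A_\alpha,\{\,,\})$ (action $a\diamond m$), with $a\diamond(b\cdot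 m)=\{a,b\}\cdot m+b\cdot(a\diamond m)$ and $(ab)\diamond m=a\cdot(b\diamond m)+b\cdot(a\diamond m)$ for $a,b\in A_\alpha,m\in M_\alpha$, and $\rho_{\alpha,\beta}(a\cdot m)=a_{(0,\alpha)}\cdot m_{(0,\alpha)}\otimes a_{(1,\beta)}m_{(1,\beta)}$, $\rho_{\alpha,\beta}(a\diamond m)=a_{(0,\alpha)}\diamond m_{(0,\alpha)}\otimes a_{(1,\beta)}m_{(1,\beta)}$ for $a\in A_{\alpha\beta},m\in M_{\alpha\beta}$. ${}_{\mathcal{P}A}\mathcal{M}^H$ is the category of Poisson $(A,H)$-Hopf modules with the $A$-linear, Lie $A$-linear, $H$-colinear families of maps. $A$ itself is an object, with $a\diamond b=\{a,b\}$. Coinvariants: $M^{coH}_\alpha$ is the image in $M_\alpha$ of the set of families $(m_\alpha)\in\prod_{\alpha}M_\alpha$ with $\rho_{\alpha,\beta}(m_{\alpha\beta})=m_\alpha\otimes 1_{H_\beta}$ for all $\alpha,\beta$; $M^{coH}=\{M^{coH}_\alpha\}$. Further $M_\alpha^{A_\alpha}=\{m\in M_\alpha: a\diamond m=0\ \forall a\in A_\alpha\}$, $M^{AcoH}_\alpha=M^{coH}_\alpha\cap M_\alpha^{A_\alpha}$, $M^{AcoH}=\{M^{AcoH}_\alpha\}$; the same notation applies to $M=A$. $A^A=\{A_\alpha^{A_\alpha}\}$ is the family of Poisson centers. $\phi$ is an algebra map if every $\phi_\alpha$ is an algebra map. The action $\diamond'$: for a Poisson $(A,H)$-Hopf module $M$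 let $p^M_\alpha:M_e\to M_\alpha$, $p^M_\alpha(m)=\phi_\alpha(S_\alpha^{-1}(m_{(1,\alpha^{-1})}))\cdot m_{(0,\alpha)}$, where $\rho_{\alpha,\alpha^{-1}}(m)=m_{(0,\alpha)}\otimes m_{(1,\alpha^{-1})}$. The image of $p^M_\alpha$ is $M^{coH}_\alpha$, and the Lie algebra $A_e$ acts on $M^{coH}_\alpha$ by $a\diamond' p^M_\alpha(m)=p^M_\alpha(a\diamond m)$ for $a\in A_e,m\in M_e$. The Lie module $M^{coH}$ is trivial if $a\diamond' x=0$ for all $a\in A_e$, $x\in M_\alpha^{coH}$, $\alpha\in G$; likewise for $A^{coH}$. The category ${}_B\mathcal{M}^{H_0}$: objects are families $N=\{N_\alpha\}$ with each $N_\alpha$ a left $B_\alpha$-module, and with $N$ a right $H$-comodule which is trivial, i.e. $N=N^{coH}$; morphisms are the families of maps that are both $B$-linear and $H$-colinear. $F_1$ sends $M$ to $M^{AcoH}$ (with restricted $B$-action and coaction) and a morphism to its restriction. For a functor $F:\mathcal{C}\to\mathcal{D}$, an object $P$ of $\mathcal{C}$ is $F$-relative projective if for every morphism $i:C\to C'$ in $\mathcal{C}$ such that $F(i)$ is a split epimorphism in $\mathcal{D}$ (there is $j:F(C')\to F(C)$ with $F(i)\circ j=id$), every morphism $P\to C'$ in $\mathcal{C}$ factors through $i$.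
   Formalization: The triviality of M^{coH} under ⋄' is assumed for every Poisson (A,H)-Hopf module M, not for one given M; with a single M (e.g. M = 0, G = 1, H = k, A = k[x] with zero bracket) the claim that every object is F_1-relative projective is false. *)

(* Defs.v *)
From HB Require Import structures.
From mathcomp Require Import all_boot all_order all_algebra.
From mathcomp Require Import boolp classical_sets.

Set Implicit Arguments.
Unset Strict Implicit.
Unset Printing Implicit Defensive.
Import GRing.Theory.
Local Open Scope quotient_scope.
Local Open Scope ring_scope.

Definition bilin (k : fieldType) (U V W : lmodType k) (f : U -> V -> W) : Prop :=
  (forall v, linear (f^~ v)) /\ (forall u, linear (f u)).

(* The list [:: (u_1, v_1); ...; (u_n, v_n)] stands for the sum of the
   u_i (x) v_i; [tensor_rel] is the congruence on such formal sums generated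
   by bilinearity. Scalars need no separate place in a formal sum, since
   c (u (x) v) = (c u) (x) v. *)
Inductive tensor_rel (k : fieldType) (U V : lmodType k) :
    seq (U * V) -> seq (U * V) -> Prop :=
| TensorRefl s : tensor_rel s s
| TensorSym s t : tensor_rel s t -> tensor_rel t s
| TensorTrans s t r : tensor_rel s t -> tensor_rel t r -> tensor_rel s r
| TensorCat s s' t t' :
    tensor_rel s s' -> tensor_rel t t' -> tensor_rel (s ++ t) (s' ++ t')
| TensorSwap s t : tensor_rel (s ++ t) (t ++ s)
| TensorZero v : tensor_rel [:: (0, v)] [::]
| TensorAddl u u' v : tensor_rel [:: (u + u', v)] [:: (u, v); (u', v)]
| TensorAddr u v v' : tensor_rel [:: (u, v + v')] [:: (u, v); (u, v')]
| TensorScale c u v : tensor_rel [:: (c *: u, v)] [:: (u, c *: v)].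

Section Tensor.
Variables (k : fieldType) (U V : lmodType k).

Definition tensor_eqv (s t : seq (U * V)) : bool := `[< tensor_rel s t >].

Lemma tensor_eqv_equiv : equiv_class_of tensor_eqv.
Proof.
split=> [s|s t|t s r].
- by apply/asboolP; apply: TensorRefl.
- by apply/asboolP/asboolP => ?; apply: TensorSym.
- by move=> /asboolP st /asboolP tr; apply/asboolP; apply: TensorTrans st tr.
Qed.

Canonical tensor_equiv := EquivRelPack tensor_eqv_equiv.

Definition tensor : Type := {eq_quot tensor_equiv}.
HB.instance Definition _ := Choice.on tensor.
HB.instance Definition _ := Quotient.on tensor.

Definition tpi (s : seq (U * V)) : tensor := \pi s.

Lemma tpiW (x : tensor) : exists s, x = tpi s.
Proof. by exists (repr x); rewrite /tpi reprK. Qed.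

Lemma tensor_piP (s t : seq (U * V)) :
  (tpi s = tpi t) <-> tensor_rel s t.
Proof.
split=> [/eqquotP /asboolP //|st]; apply/eqquotP; exact/asboolP.
Qed.

Definition tens (u : U) (v : V) : tensor := tpi [:: (u, v)].

Definition tensor_add (x y : tensor) : tensor := tpi (repr x ++ repr y).
Definition tensor_scale (c : k) (x : tensor) : tensor :=
  tpi [seq (c *: p.1, p.2) | p <- repr x].

Lemma repr_rel (s : seq (U * V)) : tensor_rel (repr (tpi s)) s.
Proof. by apply/tensor_piP; rewrite /tpi reprK. Qed.

Lemma tensor_addE s t : tensor_add (tpi s) (tpi t) = tpi (s ++ t).
Proof. by apply/tensor_piP; apply: TensorCat; apply: repr_rel. Qed.

Lemma scale_rel c (s t : seq (U * V)) : tensor_rel s t ->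
  tensor_rel [seq (c *: p.1, p.2) | p <- s] [seq (c *: p.1, p.2) | p <- t].
Proof.
elim=> {s t} /=.
- by move=> s; apply: TensorRefl.
- by move=> s t _ ?; apply: TensorSym.
- by move=> s t r _ st _ tr; apply: TensorTrans st tr.
- by move=> s s' t t' _ ? _ ?; rewrite !map_cat; apply: TensorCat.
- by move=> s t; rewrite !map_cat; apply: TensorSwap.
- by move=> v; rewrite scaler0; apply: TensorZero.
- by move=> u u' v; rewrite scalerDr; apply: TensorAddl.
- by move=> u v v'; apply: TensorAddr.
- by move=> d u v; rewrite scalerA mulrC -scalerA; apply: TensorScale.
Qed.

Lemma tensor_scaleE c s :
  tensor_scale c (tpi s) = tpi [seq (c *: p.1, p.2) | p <- s].
Proof. by apply/tensor_piP; apply: scale_rel; apply: repr_rel. Qed.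

Lemma tensor_sub_rel (s : seq (U * V)) :
  tensor_rel ([seq ((-1) *: p.1, p.2) | p <- s] ++ s) [::].
Proof.
elim: s => [|[u v] s IH] /=; first exact: TensorRefl.
set t := map _ _ in IH *.
apply: (TensorTrans (t := [:: ((-1) *: u, v); (u, v)] ++ (t ++ s))).
  rewrite -cat1s -[_ :: s]cat1s; rewrite [in X in tensor_rel _ X]cat_cons.
  rewrite -[X in tensor_rel _ X]cat1s; apply: TensorCat; first exact: TensorRefl.
  rewrite !catA; apply: TensorCat; [exact: TensorSwap|exact: TensorRefl].
rewrite -[X in tensor_rel _ X]cats0; apply: (TensorCat _ IH).
apply: (@TensorTrans k U V _ [:: (0, v)] _ _ (@TensorZero k U V v)).
rewrite -[X in tensor_rel _ [:: (X, _)]](addNr u) -scaleN1r.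
by apply: TensorSym; apply: TensorAddl.
Qed.

Lemma tensor_addA : associative tensor_add.
Proof.
move=> x y z; have [s ->] := tpiW x; have [t ->] := tpiW y; have [r ->] := tpiW z.
by rewrite !tensor_addE catA.
Qed.
Lemma tensor_addC : commutative tensor_add.
Proof.
move=> x y; have [s ->] := tpiW x; have [t ->] := tpiW y; rewrite !tensor_addE.
by apply/tensor_piP; apply: TensorSwap.
Qed.
Lemma tensor_add0 : left_id (tpi [::]) tensor_add.
Proof. by move=> x; have [s ->] := tpiW x; rewrite tensor_addE. Qed.
Lemma tensor_addN : left_inverse (tpi [::]) (tensor_scale (-1)) tensor_add.
Proof.
move=> x; have [s ->] := tpiW x; rewrite tensor_scaleE tensor_addE.
by apply/tensor_piP; apply: tensor_sub_rel.
Qed.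

HB.instance Definition _ :=
  GRing.isZmodule.Build tensor tensor_addA tensor_addC tensor_add0 tensor_addN.

Lemma tensor_piD s t : tpi (s ++ t) = tpi s + tpi t :> tensor.
Proof. by rewrite -tensor_addE. Qed.

Lemma tensor_scaleA a b x : tensor_scale a (tensor_scale b x) = tensor_scale (a * b) x.
Proof.
have [s ->] := tpiW x; rewrite !tensor_scaleE -map_comp; congr (tpi _).
by apply: eq_map => p /=; rewrite scalerA.
Qed.
Lemma tensor_scale1 : left_id 1 tensor_scale.
Proof.
move=> x; have [s ->] := tpiW x; rewrite tensor_scaleE; congr (tpi _).
by rewrite -[RHS]map_id; apply: eq_map => -[u v] /=; rewrite scale1r.
Qed.
Lemma tensor_scaleDr : right_distributive tensor_scale +%R.
Proof.
move=> c x y; have [s ->] := tpiW x; have [t ->] := tpiW y.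
by rewrite -tensor_piD !tensor_scaleE map_cat tensor_piD.
Qed.
Lemma tensor_scaleDl x : {morph tensor_scale^~ x : a b / a + b}.
Proof.
move=> a b; have [s ->] := tpiW x; rewrite !tensor_scaleE -tensor_piD; apply/tensor_piP.
elim: s => [|[u v] s IH] /=; first exact: TensorRefl.
set t1 := map _ s in IH *; set t2 := map _ s in IH *; set t3 := map _ s in IH *.
apply: (TensorTrans (t := [:: (a *: u, v); (b *: u, v)] ++ (t2 ++ t3))).
  rewrite -cat1s; apply: (TensorCat _ IH); rewrite scalerDl; exact: TensorAddl.
rewrite cat_cons -[X in tensor_rel X _]cat1s -[X in tensor_rel _ X]cat1s.
apply: TensorCat; first exact: TensorRefl.
rewrite -[(b *: u, v) :: t3]cat1s !catA; apply: TensorCat; last exact: TensorRefl.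
exact: TensorSwap.
Qed.

HB.instance Definition _ := GRing.Zmodule_isLmodule.Build k tensor
  tensor_scaleA tensor_scale1 tensor_scaleDr tensor_scaleDl.

Lemma tpi_scale c s : c *: tpi s = tpi [seq (c *: p.1, p.2) | p <- s].
Proof. exact: tensor_scaleE. Qed.

Lemma tens_bilin : bilin tens.
Proof.
split=> [v a u u'|u a v v'] /=.
  rewrite /tens tpi_scale -tensor_piD /=.
  by apply/tensor_piP; apply: TensorAddl.
rewrite /tens tpi_scale -tensor_piD /=.
apply/tensor_piP; apply: TensorTrans; first exact: TensorAddr.
rewrite -cat1s -[X in tensor_rel _ X]cat1s; apply: TensorCat; last exact: TensorRefl.
by apply: TensorSym; apply: TensorScale.
Qed.

Lemma tensE (t : tensor) : t = \sum_(p <- repr t) tens p.1 p.2.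
Proof.
rewrite -{1}(reprK t) -/(tpi _); elim: (repr t) => [|[u v] s IH]; first by rewrite big_nil.
by rewrite big_cons -IH -cat1s tensor_piD.
Qed.

Lemma tens_ind (P : tensor -> Prop) :
  P 0 -> (forall u v t, P t -> P (tens u v + t)) -> forall t, P t.
Proof.
move=> P0 PD t; rewrite [t]tensE; elim: (repr t) => [|[u v] s IH].
  by rewrite big_nil.
by rewrite big_cons; apply: PD.
Qed.

(* The map on U (x) V induced by f; meaningful when f is bilinear (only then
   does it not depend on the formal sum chosen to represent t), which is the
   case in every use below. *)
Definition tlift (W : lmodType k) (f : U -> V -> W) (t : tensor) : W :=
  \sum_(p <- repr t) f p.1 p.2.

Lemma bilin0l (W : lmodType k) (f : U -> V -> W) : bilin f -> forall v, f 0 v = 0.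
Proof. by case=> fl _ v; have := fl v (-1) 0 0; rewrite scaler0 addr0 scaleN1r addNr. Qed.

Lemma bilin_rel (W : lmodType k) (f : U -> V -> W) (s t : seq (U * V)) :
  bilin f -> tensor_rel s t -> \sum_(p <- s) f p.1 p.2 = \sum_(p <- t) f p.1 p.2.
Proof.
move=> bf; have f0 := bilin0l bf; case: (bf) => fl fr.
have f0r u : f u 0 = 0.
  by have := fr u (-1) 0 0; rewrite scaler0 addr0 scaleN1r addNr.
elim=> {s t} /=.
- by [].
- by [].
- by move=> s t r _ -> _ ->.
- by move=> s s' t t' _ e _ e'; rewrite !big_cat /= e e'.
- by move=> s t; rewrite !big_cat /= addrC.
- by move=> v; rewrite big_seq1 big_nil.
- move=> u u' v; rewrite !big_cons !big_nil !addr0 /=.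
  by have := fl v 1 u u'; rewrite !scale1r.
- move=> u v v'; rewrite !big_cons !big_nil !addr0 /=.
  by have := fr u 1 v v'; rewrite !scale1r.
- move=> c u v; rewrite !big_seq1 /=.
  have := fl v c u 0; rewrite !addr0 f0 addr0 => ->.
  by have := fr u c v 0; rewrite !addr0 f0r addr0 => ->.
Qed.

Section Lift.
Variables (W : lmodType k) (f : U -> V -> W).
Hypothesis bf : bilin f.

Lemma tlift_pi s : tlift f (tpi s) = \sum_(p <- s) f p.1 p.2.
Proof. by apply: bilin_rel => //; apply: repr_rel. Qed.

Lemma tlift_tens u v : tlift f (tens u v) = f u v.
Proof. by rewrite tlift_pi big_seq1. Qed.

Lemma tlift_linear : linear (tlift f).
Proof.
move=> a x y; have [s ->] := tpiW x; have [t ->] := tpiW y.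
rewrite tpi_scale -tensor_piD !tlift_pi big_cat /= big_map.
congr (_ + _); rewrite scaler_sumr; apply: eq_bigr => p _ /=.
have := bf.1 p.2 a p.1 0; rewrite !addr0 => ->.
by rewrite (bilin0l bf) addr0.
Qed.
End Lift.

End Tensor.

Section LinearFun.
Variables (k : fieldType) (U V : lmodType k) (f : U -> V).
Hypothesis fl : linear f.
Lemma lin0 : f 0 = 0.
Proof. by have := fl (-1) 0 0; rewrite scaler0 addr0 scaleN1r addNr. Qed.
Lemma linD u v : f (u + v) = f u + f v.
Proof. by have := fl 1 u v; rewrite !scale1r. Qed.
Lemma linZ c u : f (c *: u) = c *: f u.
Proof. by have := fl c u 0; rewrite lin0 !addr0. Qed.
End LinearFun.

Lemma linP (k : fieldType) (U V : lmodType k) (f : U -> V) :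
  (forall u v, f (u + v) = f u + f v) -> (forall c u, f (c *: u) = c *: f u) -> linear f.
Proof. by move=> fD fZ c u v; rewrite fD fZ. Qed.

Lemma lin_comp (k : fieldType) (U V W : lmodType k) (f : V -> W) (g : U -> V) :
  linear f -> linear g -> linear (fun x => f (g x)).
Proof. by move=> fl gl c u v; rewrite gl fl. Qed.

Lemma lin_id (k : fieldType) (U : lmodType k) : linear (@id U).
Proof. by []. Qed.

Lemma tens_ext (k : fieldType) (U V W : lmodType k) (f g : tensor U V -> W) :
  linear f -> linear g -> (forall u v, f (tens u v) = g (tens u v)) -> f =1 g.
Proof.
move=> fl gl fg; apply: tens_ind => [|u v t IH]; first by rewrite !lin0.
by rewrite !linD // fg IH.
Qed.

Lemma bilin_lin2 (k : fieldType) (U U' V V' W : lmodType k) (f : U -> V -> W)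
    (g : U' -> U) (h : V' -> V) :
  bilin f -> linear g -> linear h -> bilin (fun u v => f (g u) (h v)).
Proof.
move=> [fl fr] gl hl; split=> [v c u u'|u c v v'] /=; first by rewrite gl fl.
by rewrite hl fr.
Qed.

Lemma lin_bilin (k : fieldType) (U V W X : lmodType k) (f : U -> V -> W) (g : W -> X) :
  bilin f -> linear g -> bilin (fun u v => g (f u v)).
Proof.
by move=> [fl fr] gl; split=> [v c u u'|u c v v'] /=; rewrite ?fl ?fr gl.
Qed.

Section TensorMaps.
Variable k : fieldType.

Definition tmap (U V U' V' : lmodType k) (f : U -> U') (g : V -> V')
    (t : tensor U V) : tensor U' V' :=
  tlift (fun u v => tens (f u) (g v)) t.

(* (u (x) v, u' (x) v') |-> f u u' (x) g v v' *)
Definition tmap2 (U V U' V' U'' V'' : lmodType k)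
    (f : U -> U' -> U'') (g : V -> V' -> V'')
    (s : tensor U V) (t : tensor U' V') : tensor U'' V'' :=
  tlift (fun u v => tmap (f u) (g v) t) s.

Definition tassoc (U V W : lmodType k) (t : tensor (tensor U V) W) :
    tensor U (tensor V W) :=
  tlift (fun s w => tlift (fun u v => tens u (tens v w)) s) t.

Section Tmap.
Variables (U V U' V' : lmodType k) (f : U -> U') (g : V -> V').
Hypotheses (fl : linear f) (gl : linear g).

Lemma tmap_bilin : bilin (fun u v => tens (f u) (g v)).
Proof. exact: bilin_lin2 (tens_bilin _ _) fl gl. Qed.
Lemma tmap_tens u v : tmap f g (tens u v) = tens (f u) (g v).
Proof. exact: tlift_tens tmap_bilin u v. Qed.
Lemma tmap_linear : linear (tmap f g).
Proof. exact: tlift_linear tmap_bilin. Qed.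
End Tmap.

Section Tmap2.
Variables (U V U' V' U'' V'' : lmodType k).
Variables (f : U -> U' -> U'') (g : V -> V' -> V'').
Hypotheses (bf : bilin f) (bg : bilin g).

Lemma tmap2_bilin1 t : bilin (fun u v => tmap (f u) (g v) t).
Proof.
have [fl fr] := bf; have [gl gr] := bg; have [tl tr] := tens_bilin U'' V''.
split=> [v c u u'|u c v v'] /=.
  apply: (@tens_ext _ _ _ _ (tmap _ _)
    (fun t => c *: tmap (f u) (g v) t + tmap (f u') (g v) t)).
  - exact: tmap_linear.
  - move=> a x y; rewrite !(tmap_linear (fr _) (gr _)) !scalerDr !scalerA mulrC.
    by rewrite addrACA.
  - by move=> x y; rewrite !tmap_tens // (fl x) tl.
apply: (@tens_ext _ _ _ _ (tmap _ _)
    (fun t => c *: tmap (f u) (g v) t + tmap (f u) (g v') t)).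
- exact: tmap_linear.
- move=> a x y; rewrite !(tmap_linear (fr _) (gr _)) !scalerDr !scalerA mulrC.
  by rewrite addrACA.
- by move=> x y; rewrite !tmap_tens // (gl y) tr.
Qed.

Lemma tmap2_bilin : bilin (tmap2 f g).
Proof.
split=> [t|s]; first exact: tlift_linear (tmap2_bilin1 t).
move=> c t t'; move: s.
apply: (@tens_ext _ _ _ _ (fun s => tmap2 f g s (c *: t + t'))
    (fun s => c *: tmap2 f g s t + tmap2 f g s t')).
- exact: tlift_linear (tmap2_bilin1 _).
- move=> a x y; rewrite /tmap2 !(tlift_linear (tmap2_bilin1 _)).
  by rewrite !scalerDr !scalerA mulrC addrACA.
- move=> u v; rewrite /tmap2 !(tlift_tens (tmap2_bilin1 _)).
  by rewrite (tmap_linear (bf.2 _) (bg.2 _)).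
Qed.

Lemma tmap2_tens u v u' v' :
  tmap2 f g (tens u v) (tens u' v') = tens (f u u') (g v v').
Proof.
rewrite /tmap2 (tlift_tens (tmap2_bilin1 _)) tmap_tens //; first exact: bf.2.
exact: bg.2.
Qed.
End Tmap2.

Section Tassoc.
Variables (U V W : lmodType k).
Lemma tassoc_bilin1 (w : W) : bilin (fun (u : U) (v : V) => tens u (tens v w)).
Proof.
have [tl tr] := tens_bilin U (tensor V W); have [sl sr] := tens_bilin V W.
by split=> [v c u u'|u c v v']; rewrite ?tl // (sl w) tr.
Qed.
Lemma tassoc_bilin :
  bilin (fun (s : tensor U V) (w : W) => tlift (fun u v => tens u (tens v w)) s).
Proof.
split=> [w|s c w w']; first exact: tlift_linear (tassoc_bilin1 w).
have [tl tr] := tens_bilin U (tensor V W); have [sl sr] := tens_bilin V W.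
move: s; apply: (@tens_ext _ _ _ _ (fun s => tlift _ s)
    (fun s => c *: tlift _ s + tlift _ s)).
- exact: tlift_linear (tassoc_bilin1 _).
- move=> a x y; rewrite !(tlift_linear (tassoc_bilin1 _)).
  by rewrite !scalerDr !scalerA mulrC addrACA.
- by move=> u v; rewrite !(tlift_tens (tassoc_bilin1 _)) sr tr.
Qed.
Lemma tassoc_tens u v w : tassoc (tens (tens u v) w) = tens u (tens v w) :> tensor U (tensor V W).
Proof. by rewrite /tassoc (tlift_tens tassoc_bilin) (tlift_tens (tassoc_bilin1 _)). Qed.
Lemma tassoc_linear : linear (@tassoc U V W).
Proof. exact: tlift_linear tassoc_bilin. Qed.
End Tassoc.
End TensorMaps.

(* Unital associative k-algebras. The library's [algType] excludes the zero
   algebra, which may occur here as some H_alpha or A_alpha. *)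
HB.mixin Record isPzAlgebra (k : fieldType) A of GRing.Lmodule k A := {
  amul : A -> A -> A;
  aone : A;
  amul_bilin : bilin amul;
  amulA : associative amul;
  amul1x : left_id aone amul;
  amulx1 : right_id aone amul
}.
#[short(type="pzAlgType")]
HB.structure Definition PzAlgebra (k : fieldType) :=
  {A of isPzAlgebra k A & GRing.Lmodule k A}.
Notation "x ** y" := (amul x y) (at level 40, left associativity) : ring_scope.

HB.mixin Record isPoisson (k : fieldType) A of PzAlgebra k A := {
  amulC : commutative (amul : A -> A -> A);
  pbracket : A -> A -> A;
  pbracket_bilin : bilin pbracket;
  pbracketxx : forall a, pbracket a a = 0;
  pbracket_jacobi : forall a b c,
    pbracket a (pbracket b c) + pbracket b (pbracket c a)
      + pbracket c (pbracket a b) = 0;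
  pbracket_leibniz : forall a b c,
    pbracket a (b ** c) = pbracket a b ** c + b ** pbracket a c
}.
#[short(type="poissonAlgType")]
HB.structure Definition PoissonAlgebra (k : fieldType) :=
  {A of isPoisson k A & PzAlgebra k A}.

Section TensorAlgebra.
Variables (k : fieldType) (A B : pzAlgType k).
Definition tensor_mul : tensor A B -> tensor A B -> tensor A B :=
  tmap2 (@amul k A) (@amul k B).
Definition tensor_one : tensor A B := tens aone aone.

Lemma tensor_mul_bilin : bilin tensor_mul.
Proof. exact: tmap2_bilin amul_bilin amul_bilin. Qed.
Let tmb := tensor_mul_bilin.
Lemma tensor_mulE a b a' b' :
  tensor_mul (tens a b) (tens a' b') = tens (a ** a') (b ** b').
Proof. exact: tmap2_tens amul_bilin amul_bilin _ _ _ _. Qed.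

Lemma tensor_mulA : associative tensor_mul.
Proof.
move=> x y z; move: x; apply: (@tens_ext _ _ _ _ (fun x => tensor_mul x (tensor_mul y z))
  (fun x => tensor_mul (tensor_mul x y) z)).
- exact: tmb.1.
- by apply: (lin_comp (f := tensor_mul^~ z)); apply: tmb.1.
move=> a b; move: y; apply: (@tens_ext _ _ _ _ (fun y => tensor_mul _ (tensor_mul y z))
  (fun y => tensor_mul (tensor_mul (tens a b) y) z)).
- by apply: (lin_comp (g := tensor_mul^~ z)); [apply: tmb.2|apply: tmb.1].
- by apply: (lin_comp (f := tensor_mul^~ z)); [apply: tmb.1|apply: tmb.2].
move=> a' b'; move: z; apply: (@tens_ext _ _ _ _ (fun z => tensor_mul _ (tensor_mul _ z))
  (fun z => tensor_mul (tensor_mul (tens a b) (tens a' b')) z)).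
- by apply: (lin_comp (f := tensor_mul _)); apply: tmb.2.
- exact: tmb.2.
by move=> a'' b''; rewrite !tensor_mulE !amulA.
Qed.
Lemma tensor_mul1x : left_id tensor_one tensor_mul.
Proof.
apply: (@tens_ext _ _ _ _ (tensor_mul tensor_one) id); [exact: tmb.2|exact: lin_id|].
by move=> a b; rewrite tensor_mulE !amul1x.
Qed.
Lemma tensor_mulx1 : right_id tensor_one tensor_mul.
Proof.
apply: (@tens_ext _ _ _ _ (tensor_mul^~ tensor_one) id); [exact: tmb.1|exact: lin_id|].
by move=> a b; rewrite tensor_mulE !amulx1.
Qed.

HB.instance Definition _ := isPzAlgebra.Build k (tensor A B)
  tensor_mul_bilin tensor_mulA tensor_mul1x tensor_mulx1.

Lemma tensM (a a' : A) (b b' : B) : tens a b ** tens a' b' = tens (a ** a') (b ** b').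
Proof. exact: tensor_mulE. Qed.
Lemma tens1 : tens aone aone = aone :> tensor A B.
Proof. by []. Qed.
End TensorAlgebra.

Definition algebra_map (k : fieldType) (A B : pzAlgType k) (f : A -> B) : Prop :=
  [/\ linear f, f aone = aone & {morph f : x y / x ** y}].

Record subspace (k : fieldType) (V : lmodType k) := Subspace {
  sub_mem :> V -> Prop;
  sub_mem0 : sub_mem 0;
  sub_memP : forall c u v, sub_mem u -> sub_mem v -> sub_mem (c *: u + v)
}.

Section Subspace.
Variables (k : fieldType) (V : lmodType k) (S : subspace V).

Definition sub_pred : {pred V} := fun v => `[< S v >].

Lemma sub_predP v : reflect (S v) (v \in sub_pred).
Proof. exact: asboolP. Qed.

Lemma sub_memD u v : S u -> S v -> S (u + v).
Proof. by move=> Su Sv; rewrite -[u]scale1r; apply: sub_memP. Qed.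
Lemma sub_memZ c u : S u -> S (c *: u).
Proof. by move=> Su; rewrite -[_ *: _]addr0; apply: sub_memP => //; apply: sub_mem0. Qed.
Lemma sub_memB u v : S u -> S v -> S (u - v).
Proof. by move=> Su Sv; rewrite -scaleN1r addrC; apply: sub_memP. Qed.

Lemma sub_pred_closed : subsemimod_closed sub_pred.
Proof.
split; first split.
- by apply/sub_predP; apply: sub_mem0.
- by move=> u v /sub_predP Su /sub_predP Sv; apply/sub_predP; apply: sub_memD.
- by move=> c u /sub_predP Su; apply/sub_predP; apply: sub_memZ.
Qed.
HB.instance Definition _ := GRing.isSubmodClosed.Build k V sub_pred sub_pred_closed.

Definition subsp := {v : V | v \in sub_pred}.
HB.instance Definition _ := SubChoice.on subsp.
HB.instance Definition _ := [SubChoice_isSubLmodule of subsp by <:].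

Definition sub_val (x : subsp) : V := val x.
Definition sub_in v (Sv : S v) : subsp := exist _ v (introT (sub_predP v) Sv).

Lemma sub_valP (x : subsp) : S (sub_val x).
Proof. by apply/sub_predP; apply: (valP x). Qed.
Lemma sub_val_inj : injective sub_val.
Proof. exact: val_inj. Qed.
Lemma sub_val_linear : linear sub_val.
Proof. by move=> c x y; rewrite /sub_val linearP. Qed.
Lemma sub_inK v (Sv : S v) : sub_val (sub_in Sv) = v.
Proof. by []. Qed.

Lemma subspace_retract :
  exists r : V -> V, [/\ linear r, forall v, S (r v) & forall v, S v -> r v = v].
Proof.
pose P (C : set V) := (forall c u v, C u -> C v -> C (c *: u + v)) /\
  (forall u, C u -> S u -> u = 0).
have [|A [[Alin AS] Amax]] := @Zorn_bigcup V P.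
  move=> F FP Ftot; split.
    move=> c u v [C FC Cu] [D FD Dv].
    have [CD|DC] := Ftot _ _ FC FD.
      by exists D => //; apply: (FP _ FD).1 => //; apply: CD.
    by exists C => //; apply: (FP _ FC).1 => //; apply: DC.
  by move=> u [C FC Cu]; apply: (FP _ FC).2.
pose A0 v := A v \/ v = 0.
have AZ c u : A u -> A0 (c *: u).
  move=> Au; have := Alin (-1) u u Au Au.
  rewrite scaleN1r addNr => A00; left; rewrite -[_ *: _]addr0; exact: Alin.
have A0lin c u v : A0 u -> A0 v -> A0 (c *: u + v).
  move=> [Au|->] [Av|->].
  - by left; apply: Alin.
  - by rewrite addr0; apply: AZ.
  - by rewrite scaler0 add0r; left.
  - by rewrite scaler0 addr0; right.
have A0S u : A0 u -> S u -> u = 0 by case=> // /AS.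
have dec v : exists s, S s /\ A0 (v - s).
  apply: contrapT => nv.
  pose B : set V := fun w => exists t c, A0 c /\ w = t *: v + c.
  apply: (Amax B); first split.
  - by move=> u Au; exists 0, u; rewrite scale0r add0r; split=> //; left.
  - move=> BA; apply: nv; exists 0; rewrite subr0; split; first exact: sub_mem0.
    by left; apply: BA; exists 1, 0; rewrite scale1r addr0; split=> //; right.
  split.
    move=> c _ _ [t [a [Aa ->]]] [t' [a' [Aa' ->]]].
    exists (c * t + t'), (c *: a + a'); split; first exact: A0lin.
    by rewrite scalerDr scalerA addrACA -scalerDl.
  move=> _ [t [a [Aa ->]]] Sw; case: (eqVneq t 0) => [t0|tN0].
    by move: Sw; rewrite t0 scale0r add0r; apply: A0S.
  case: nv; exists (t^-1 *: (t *: v + a)); split; first exact: sub_memZ.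
  rewrite scalerDr scalerA mulVf // scale1r opprD addrA subrr add0r -scaleNr.
  by rewrite -[_ *: _]addr0; apply: A0lin => //; right.
have [r rP] := choice dec.
have uniq v s : S s -> A0 (v - s) -> r v = s.
  move=> Ss As; have [Sr Ar] := rP v; apply/eqP; rewrite -subr_eq0; apply/eqP.
  apply: A0S; last exact: sub_memB.
  have := A0lin (-1) _ _ Ar As; rewrite scaleN1r opprB.
  by rewrite addrA subrK.
exists r; split=> [c u v|v|v Sv]; last 1 first.
- by apply: uniq => //; rewrite subrr; right.
- have [Su Au] := rP u; have [Sv Av] := rP v; apply: uniq; first exact: sub_memP.
  by have := A0lin c _ _ Au Av; rewrite scalerBr opprD addrACA.
- by have [] := rP v.
Qed.

End Subspace.

Lemma tmap_comp (k : fieldType) (U V U' V' U'' V'' : lmodType k) (f : U -> U')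
    (g : V -> V') (f' : U' -> U'') (g' : V' -> V'') t :
  linear f -> linear g -> linear f' -> linear g' ->
  tmap f' g' (tmap f g t) = tmap (fun u => f' (f u)) (fun v => g' (g v)) t.
Proof.
move=> fl gl fl' gl'; have fl2 := lin_comp fl' fl; have gl2 := lin_comp gl' gl.
move: t; apply: (tens_ext (f := fun t => tmap f' g' (tmap f g t))).
- exact: lin_comp (tmap_linear fl' gl') (tmap_linear fl gl).
- exact: tmap_linear.
by move=> u v; rewrite !tmap_tens.
Qed.

Lemma tmap_id (k : fieldType) (U V : lmodType k) (f : U -> U) (g : V -> V) (t : tensor U V) :
  f =1 id -> g =1 id -> tmap f g t = t.
Proof.
move=> /funext -> /funext ->.
move: t; apply: (tens_ext (g := id)); [exact: tmap_linear|exact: lin_id|].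
by move=> u v; rewrite tmap_tens.
Qed.

Lemma sub_retract (k : fieldType) (V : lmodType k) (S : subspace V) :
  exists r : V -> subsp S, linear r /\ cancel (@sub_val _ _ S) r.
Proof.
have [r [rl rS rK]] := subspace_retract S; exists (fun v => sub_in (rS v)); split.
  by move=> c u v; apply: sub_val_inj; rewrite sub_val_linear !sub_inK rl.
by move=> x; apply: sub_val_inj; rewrite sub_inK rK //; apply: sub_valP.
Qed.

Lemma tmap_sub_inj (k : fieldType) (V W : lmodType k) (S : subspace V) :
  injective (tmap (@sub_val _ _ S) (@id W)).
Proof.
have [r [rl rK]] := sub_retract S; apply: (can_inj (g := tmap r id)) => t.
by rewrite tmap_comp ?tmap_id //; apply: sub_val_linear.
Qed.

Lemma tens_eq0 (k : fieldType) (U V : lmodType k) (u : U) (v : V) :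
  tens u v = 0 -> u = 0 \/ v = 0.
Proof.
move=> uv0; case: (eqVneq v 0) => [|vN0]; [by right|left].
have L0 : exists c, 0 = c *: v by exists 0; rewrite scale0r.
have LP c x y : (exists a, x = a *: v) -> (exists a, y = a *: v) ->
    exists a, c *: x + y = a *: v.
  by move=> [a ->] [b ->]; exists (c * a + b); rewrite scalerDl scalerA.
have [r [rl rS rK]] := subspace_retract (Subspace L0 LP).
have [f fP] := choice rS.
have vI a b : a *: v = b *: v -> a = b.
  move=> ab; apply/eqP; rewrite -subr_eq0; have : (a - b) *: v = 0.
    by rewrite scalerBl ab subrr.
  by move/eqP; rewrite scaler_eq0 (negPf vN0) orbF.
have f1 : f v = 1 by apply: vI; rewrite -fP scale1r rK //; exists 1; rewrite scale1r.
have fl : linear (f : V -> k^o).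
  move=> c x y; apply: vI; rewrite -fP rl !fP scalerDl /=.
  by rewrite scalerA.
have bf : bilin (fun (x : U) (y : V) => f y *: x).
  split=> [y c x x'|x c y y'] /=.
    by rewrite scalerDr !scalerA mulrC.
  by rewrite (fl c y y') scalerDl scalerA.
have := congr1 (tlift (fun (x : U) (y : V) => f y *: x)) uv0.
by rewrite (tlift_tens bf) f1 scale1r (lin0 (tlift_linear bf)).
Qed.

(* The abelian group G is written additively. To avoid transports along
   equations between indices, Delta_{a,b} is given on every H_c with
   c = a + b, and S_a with values in every H_b with b = - a; taking c := a + b,
   b := - a and the proof [erefl] gives the usual data, and the equation
   determines the value at any other proof. The same device is used for the
   coactions below. *)
Record hopfGcoalgebra (k : fieldType) (G : zmodType) := HopfGCoalgebra {
  hcar :> G -> pzAlgType k;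
  hdelta : forall c a b : G, c = a + b ->
    {linear hcar c -> tensor (hcar a) (hcar b)};
  heps : hcar 0 -> k;
  hanti : forall a b : G, b = - a -> {linear hcar a -> hcar b};
  hdelta_alg : forall c a b (E : c = a + b), algebra_map (hdelta E);
  heps_linear : linear (heps : hcar 0 -> k^o);
  heps1 : heps aone = 1;
  hepsM : forall x y, heps (x ** y) = heps x * heps y;
  hdelta_coassoc : forall a b c ab bc abc (Eab : ab = a + b)
      (Eabc : abc = ab + c) (Ebc : bc = b + c) (Eabc' : abc = a + bc) h,
    tassoc (tmap (hdelta Eab) id (hdelta Eabc h))
      = tmap id (hdelta Ebc) (hdelta Eabc' h);
  hcounitr : forall a (E : a = a + 0) h,
    tlift (fun x y => heps y *: x) (hdelta E h) = h;
  hcounitl : forall a (E : a = 0 + a) h,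
    tlift (fun x y => heps x *: y) (hdelta E h) = h;
  hantil : forall a a' (E : 0 = a' + a) (E' : a = - a') h,
    tlift (fun x y => hanti E' x ** y) (hdelta E h) = heps h *: aone;
  hantir : forall a a' (E : 0 = a + a') (E' : a = - a') h,
    tlift (fun x y => x ** hanti E' y) (hdelta E h) = heps h *: aone
}.

Arguments hdelta {k G} H {c a b} E : rename.
Arguments heps {k G} H : rename.
Arguments hanti {k G} H {a b} E : rename.

Definition bijective_antipode (k : fieldType) (G : zmodType)
    (H : hopfGcoalgebra k G) : Prop :=
  forall a b (E : b = - a), bijective (hanti H E).

(* S_a^{-1} : H_{-a} -> H_a; the inverse of S_a when S_a is bijective. *)
Definition hanti_inv (k : fieldType) (G : zmodType) (H : hopfGcoalgebra k G)
    (a : G) (h : H (- a)) : H a :=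
  xget 0 [set x | hanti H (erefl (- a)) x = h].

Record is_comodule (k : fieldType) (G : zmodType) (H : hopfGcoalgebra k G)
    (M : G -> lmodType k)
    (rho : forall c a b : G, c = a + b -> M c -> tensor (M a) (H b)) : Prop :=
  IsComodule {
  coact_linear : forall c a b (E : c = a + b), linear (rho c a b E);
  coact_coassoc : forall a b c ab bc abc (Eab : ab = a + b)
      (Eabc : abc = ab + c) (Ebc : bc = b + c) (Eabc' : abc = a + bc) m,
    tmap id (hdelta H Ebc) (rho _ _ _ Eabc' m)
      = tassoc (tmap (rho _ _ _ Eab) id (rho _ _ _ Eabc m));
  coact_counit : forall a (E : a = a + 0) m,
    tlift (fun x h => heps H h *: x) (rho _ _ _ E m) = m
}.

Record comodule (k : fieldType) (G : zmodType) (H : hopfGcoalgebra k G) :=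
  Comodule {
  ccar :> G -> lmodType k;
  coact : forall c a b : G, c = a + b -> ccar c -> tensor (ccar a) (H b);
  comoduleP : is_comodule coact
}.

Arguments coact {k G H} M {c a b} E m : rename.

Definition colinear (k : fieldType) (G : zmodType) (H : hopfGcoalgebra k G)
    (M N : comodule H) (f : forall a, M a -> N a) : Prop :=
  forall c a b (E : c = a + b) m,
    coact N E (f c m) = tmap (f a) id (coact M E m).

Lemma hopf_is_comodule (k : fieldType) (G : zmodType) (H : hopfGcoalgebra k G) :
  @is_comodule k G H (fun a => H a) (fun c a b E => hdelta H E).
Proof.
split=> [c a b E|a b c ab bc abc Eab Eabc Ebc Eabc' m|a E m].
- exact: linearP.
- exact: esym (hdelta_coassoc Eab Eabc Ebc Eabc' m).
- exact: hcounitr.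
Qed.
Definition hopf_comodule k G (H : hopfGcoalgebra k G) : comodule H :=
  Comodule (hopf_is_comodule H).

Record comodPoisson (k : fieldType) (G : zmodType) (H : hopfGcoalgebra k G) :=
  ComodPoisson {
  acar :> G -> poissonAlgType k;
  acoact : forall c a b : G, c = a + b -> acar c -> tensor (acar a) (H b);
  acomoduleP : is_comodule acoact;
  acoact_alg : forall c a b (E : c = a + b), algebra_map (acoact E);
  acoact_bracket : forall c a b (E : c = a + b) x y,
    acoact E (pbracket x y)
      = tmap2 pbracket amul (acoact E x) (acoact E y)
}.

Arguments acoact {k G H} A {c a b} E x : rename.

Definition poisson_comodule k G (H : hopfGcoalgebra k G) (A : comodPoisson H) :
  comodule H := Comodule (acomoduleP A).

Record is_module (k : fieldType) (R : pzAlgType k) (M : lmodType k)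
    (act : R -> M -> M) : Prop := IsModule {
  act_bilin : bilin act;
  act1 : forall m, act aone m = m;
  actM : forall a b m, act (a ** b) m = act a (act b m)
}.

Record is_lie_module (k : fieldType) (R : poissonAlgType k) (M : lmodType k)
    (lact : R -> M -> M) : Prop := IsLieModule {
  lact_bilin : bilin lact;
  lact_bracket : forall a b m,
    lact (pbracket a b) m = lact a (lact b m) - lact b (lact a m)
}.

Record poissonHopfModule (k : fieldType) (G : zmodType) (H : hopfGcoalgebra k G)
    (A : comodPoisson H) := PoissonHopfModule {
  pcomod :> comodule H;
  pact : forall a, A a -> pcomod a -> pcomod a;
  plact : forall a, A a -> pcomod a -> pcomod a;
  pactP : forall a, is_module (pact (a := a));
  plactP : forall a, is_lie_module (plact (a := a));
  plact_act : forall a (x y : A a) m,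
    plact x (pact y m) = pact (pbracket x y) m + pact y (plact x m);
  plactM : forall a (x y : A a) m,
    plact (x ** y) m = pact x (plact y m) + pact y (plact x m);
  pcoact_act : forall c a b (E : c = a + b) x m,
    coact pcomod E (pact x m)
      = tmap2 (pact (a := a)) amul (acoact A E x) (coact pcomod E m);
  pcoact_lact : forall c a b (E : c = a + b) x m,
    coact pcomod E (plact x m)
      = tmap2 (plact (a := a)) amul (acoact A E x) (coact pcomod E m)
}.

Arguments pact {k G H A} M {a} x m : rename.
Arguments plact {k G H A} M {a} x m : rename.

Section Regular.
Variables (k : fieldType) (G : zmodType) (H : hopfGcoalgebra k G).
Variable A : comodPoisson H.

Lemma pbracketC (R : poissonAlgType k) (x y : R) : pbracket x y = - pbracket y x.
Proof.
have [l r] := pbracket_bilin (s := R); have := pbracketxx (x + y).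
rewrite (linD (l _)) !(linD (r _)) !pbracketxx add0r addr0 => /eqP.
by rewrite addr_eq0 => /eqP.
Qed.

Lemma regular_module a : @is_module k (A a) (A a) amul.
Proof.
split=> [|m|x y m]; [exact: amul_bilin|exact: amul1x|by rewrite amulA].
Qed.

Lemma regular_lie_module a : @is_lie_module k (A a) (A a) pbracket.
Proof.
split=> [|x y m]; first exact: pbracket_bilin.
have [l r] := pbracket_bilin (s := A a).
have := pbracket_jacobi x y m; rewrite [pbracket m (pbracket x y)]pbracketC.
move/eqP; rewrite subr_eq0 => /eqP <-.
by rewrite [pbracket m x]pbracketC -[- pbracket x m]scaleN1r (linZ (r y)) scaleN1r.
Qed.

Lemma regular_lact_act a (x y m : A a) :
  pbracket x (y ** m) = pbracket x y ** m + y ** pbracket x m.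
Proof. exact: pbracket_leibniz. Qed.

Lemma regular_lactM a (x y m : A a) :
  pbracket (x ** y) m = x ** pbracket y m + y ** pbracket x m.
Proof.
rewrite pbracketC pbracket_leibniz opprD [pbracket m x]pbracketC.
rewrite [pbracket m y]pbracketC.
have [l r] := amul_bilin (s := A a).
rewrite -!scaleN1r (linZ (l y)) (linZ (r x)) !scalerA mulrNN mulr1 !scale1r.
by rewrite addrC [pbracket x m ** y]amulC.
Qed.

Lemma regular_coact_act c a b (E : c = a + b) (x m : A c) :
  acoact A E (x ** m) = tmap2 amul amul (acoact A E x) (acoact A E m).
Proof. by have [_ _ ->] := acoact_alg A E. Qed.

Definition regular : poissonHopfModule A :=
  @PoissonHopfModule k G H A (poisson_comodule A)
    (fun a => amul) (fun a => pbracket)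
    regular_module regular_lie_module regular_lact_act regular_lactM
    regular_coact_act (@acoact_bracket _ _ _ A).
End Regular.

Section Invariants.
Variables (k : fieldType) (G : zmodType) (H : hopfGcoalgebra k G).

Definition coinv_family (M : comodule H) (m : forall a, M a) : Prop :=
  forall c a b (E : c = a + b), coact M E (m c) = tens (m a) aone.

Definition coinv (M : comodule H) (a : G) (x : M a) : Prop :=
  exists2 m : forall a, M a, coinv_family m & m a = x.

Definition trivial_comodule (M : comodule H) : Prop :=
  forall a (x : M a), coinv x.

Variable A : comodPoisson H.

Definition lie_inv (M : poissonHopfModule A) (a : G) (x : M a) : Prop :=
  forall p : A a, plact M p x = 0.

Definition lie_coinv (M : poissonHopfModule A) (a : G) (x : M a) : Prop :=
  coinv x /\ lie_inv x.

Lemma lie_coinv0 (M : poissonHopfModule A) a : lie_coinv (0 : M a).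
Proof.
split; last by move=> p; apply: lin0; apply: (lact_bilin (plactP M a)).2.
exists (fun=> 0) => // c d b E.
rewrite (lin0 (coact_linear (comoduleP M) E)).
by rewrite (lin0 ((tens_bilin _ _).1 _)).
Qed.

Lemma lie_coinvP (M : poissonHopfModule A) a c (x y : M a) :
  lie_coinv x -> lie_coinv y -> lie_coinv (c *: x + y).
Proof.
move=> [[m mP <-] xi] [[n nP <-] yi]; split.
  exists (fun a => c *: m a + n a) => // d e b E.
  by rewrite (coact_linear (comoduleP M) E) mP nP ((tens_bilin _ _).1 _).
move=> p; have := (lact_bilin (plactP M a)).2 p c (m a) (n a).
by rewrite xi yi scaler0 addr0.
Qed.

(* M^{AcoH}_a *)
Definition lie_coinv_space (M : poissonHopfModule A) (a : G) : subspace (M a) :=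
  Subspace (lie_coinv0 M a) (@lie_coinvP M a).
End Invariants.

Section Restriction.
Variables (k : fieldType) (G : zmodType) (H : hopfGcoalgebra k G).
Variables (A : comodPoisson H) (M : poissonHopfModule A).

Lemma lie_inv_descent (m : forall a, M a) c a b (E : c = a + b) :
  coinv_family m -> lie_inv (m c) -> (aone : H b) = 0 \/ lie_inv (m a).
Proof.
move=> mP mi; case: (eqVneq (aone : H b) 0) => [|bN0]; [by left|right=> p].
have E1 : a = c + - b by rewrite E addrK.
have E0 : 0 = b + - b by rewrite subrr.
have Ea : a = a + 0 by rewrite addr0.
have Eb : b = - - b by rewrite opprK.
have coA := coact_coassoc (acomoduleP A) E E1 E0 Ea p.
have [ll lr] := lact_bilin (plactP M a).
have Sbil : bilin (fun x y => x ** hanti H Eb y).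
  by apply: (bilin_lin2 amul_bilin) => // ? ? ?; rewrite linearP.
pose T := tmap (fun q => plact M q (m a)) (tlift (fun x y => x ** hanti H Eb y)).
have Tl : linear T by apply: tmap_linear; [exact: ll|exact: tlift_linear].
have T1 z : T (tmap id (hdelta H E0) z)
    = tens (plact M (tlift (fun x h => heps H h *: x) z) (m a)) aone.
  have epsb : bilin (fun (x : A a) (h : H 0) => heps H h *: x).
    split=> [v e u u'|u e v v'] /=; first by rewrite scalerDr !scalerA mulrC.
    by rewrite heps_linear scalerDl scalerA.
  move: z; apply: (tens_ext (f := fun z => T (tmap id (hdelta H E0) z))).
  - by apply: (lin_comp Tl); apply: tmap_linear => // ? ? ?; rewrite linearP.
  - move=> e u v; rewrite (tlift_linear epsb) ll; exact: ((tens_bilin _ _).1 _).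
  move=> u h; rewrite tmap_tens //; last by move=> ? ? ?; rewrite linearP.
  rewrite /T tmap_tens //; last exact: tlift_linear.
  rewrite hantir (tlift_tens epsb) (linZ (ll _)).
  by rewrite (linZ ((tens_bilin _ _).1 _)) (linZ ((tens_bilin _ _).2 _)).
have T2 h w : T (tassoc (tens w h)) = tmap id (fun x => x ** hanti H Eb h)
    (tmap2 (plact M (a := a)) amul w (tens (m a) aone)).
  have sl : linear (fun x : H b => x ** hanti H Eb h) by apply: amul_bilin.1.
  have t2b := tmap2_bilin (lact_bilin (plactP M a)) (amul_bilin (s := H b)).
  move: w; apply: (tens_ext (f := fun w => T (tassoc (tens w h)))).
  - apply: (lin_comp Tl); apply: (lin_comp (@tassoc_linear _ _ _ _)).
    exact: (tens_bilin _ _).1.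
  - apply: (lin_comp (tmap_linear (@lin_id _ _) sl)); exact: t2b.1.
  move=> u x; rewrite tassoc_tens /T tmap_tens ?(tlift_tens Sbil) //; last first.
    exact: tlift_linear.
  rewrite (tmap2_tens (lact_bilin (plactP M a)) amul_bilin).
  by rewrite tmap_tens ?amulx1.
have T3 z : T (tassoc (tmap (acoact A E) id z)) = 0.
  have al := coact_linear (acomoduleP A) E.
  move: z; apply: (tens_ext (f := fun z => T (tassoc (tmap (acoact A E) id z)))
    (g := fun=> 0)).
  - apply: (lin_comp Tl); apply: (lin_comp (@tassoc_linear _ _ _ _)).
    exact: tmap_linear.
  - by move=> ? ? ?; rewrite scaler0 addr0.
  move=> q h; rewrite tmap_tens // T2 -(mP _ _ _ E) -pcoact_lact mi.
  rewrite (lin0 (coact_linear (comoduleP M) E)); apply: lin0.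
  by apply: tmap_linear => //; apply: amul_bilin.1.
have := T1 (acoact A Ea p); rewrite coA T3.
rewrite (coact_counit (acomoduleP A)) => /esym /tens_eq0 [//|b0].
by rewrite b0 eqxx in bN0.
Qed.

Lemma tensor_trivial (U : lmodType k) b (t : tensor U (H b)) :
  (aone : H b) = 0 -> t = 0.
Proof.
move=> b0; move: t; apply: (tens_ext (f := id) (g := fun=> 0)) => //.
- by move=> ? ? ?; rewrite scaler0 addr0.
- move=> u v; rewrite -[v]amul1x b0 (lin0 (amul_bilin.1 _)).
  exact: (lin0 ((tens_bilin _ _).2 _)).
Qed.

Let S := lie_coinv_space M.

(* The coaction of M restricted to M^{AcoH}: the unique t whose image under
   the injection M^{AcoH}_a (x) H_b -> M_a (x) H_b is rho_{a,b}(x); see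
   [restr_coactE] and [tmap_sub_inj]. *)
Definition restr_coact c a b (E : c = a + b) (x : subsp (S c)) :
    tensor (subsp (S a)) (H b) :=
  xget 0 [set t | tmap (@sub_val _ _ (S a)) id t = coact M E (sub_val x)].

Lemma restr_coact_ex c a b (E : c = a + b) (x : subsp (S c)) :
  exists y : subsp (S a), coact M E (sub_val x) = tens (sub_val y) aone.
Proof.
have [[m mP mx] xi] := sub_valP x; rewrite -mx in xi *.
have [b0|ai] := lie_inv_descent E mP xi.
  by exists 0; rewrite [LHS]tensor_trivial // [RHS]tensor_trivial.
have Sa : S a (m a) by split=> //; exists m.
by exists (sub_in Sa); rewrite sub_inK; apply: mP.
Qed.

Lemma restr_coactE c a b (E : c = a + b) (x : subsp (S c)) :
  tmap (@sub_val _ _ (S a)) id (restr_coact E x) = coact M E (sub_val x).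
Proof.
rewrite /restr_coact; case: xgetP => [y _ -> //|] nex.
have [y yE] := restr_coact_ex E x; case: (nex (tens y aone)) => /=.
by rewrite tmap_tens //; apply: sub_val_linear.
Qed.

Lemma restr_coact_is_comodule :
  @is_comodule k G H (fun a => subsp (S a)) restr_coact.
Proof.
have vl a := sub_val_linear (S := S a).
have cl c a b (E : c = a + b) : linear (restr_coact E).
  move=> e x y; apply: tmap_sub_inj.
  rewrite (tmap_linear (vl a) (@lin_id _ _)) !restr_coactE (vl c).
  exact: (coact_linear (comoduleP M) E).
split=> // [a b c ab bc abc Eab Eabc Ebc Eabc' m|a E m].
  have dl : linear (hdelta H Ebc) by move=> ? ? ?; rewrite linearP.
  apply: tmap_sub_inj; rewrite tmap_comp //.
  have -> : tmap (@sub_val _ _ (S a)) (hdelta H Ebc) (restr_coact Eabc' m)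
    = tmap id (hdelta H Ebc) (coact M Eabc' (sub_val m)).
    by rewrite -restr_coactE (tmap_comp _ (vl a) (@lin_id _ _) (@lin_id _ _) dl).
  rewrite (coact_coassoc (comoduleP M) Eab Eabc Ebc) -restr_coactE.
  have ML := coact_linear (comoduleP M) Eab.
  rewrite tmap_comp //; move: (restr_coact Eabc m).
  apply: (tens_ext (f := fun t => tassoc (tmap _ _ t))
    (g := fun t => tmap _ id (tassoc (tmap _ _ t)))).
  - apply: (lin_comp (@tassoc_linear _ _ _ _)); apply: tmap_linear => //.
    exact: lin_comp.
  - apply: (lin_comp (tmap_linear (vl a) (@lin_id _ _))).
    apply: (lin_comp (@tassoc_linear _ _ _ _)); apply: tmap_linear; first exact: cl.
    exact: lin_id.
  move=> u h; rewrite !tmap_tens //; [|exact: cl|exact: lin_comp].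
  rewrite -restr_coactE; move: (restr_coact Eab u).
  apply: (tens_ext (f := fun t => tassoc (tens (tmap _ _ t) _))
    (g := fun t => tmap _ id (tassoc (tens t _)))).
  - apply: (lin_comp (@tassoc_linear _ _ _ _)).
    by apply: (lin_comp ((tens_bilin _ _).1 _)); apply: tmap_linear.
  - apply: (lin_comp (tmap_linear (vl a) (@lin_id _ _))).
    by apply: (lin_comp (@tassoc_linear _ _ _ _)); apply: (tens_bilin _ _).1.
  by move=> v g; rewrite tmap_tens // !tassoc_tens tmap_tens.
apply: sub_val_inj; rewrite -[RHS](coact_counit (comoduleP M) E) -restr_coactE.
have eb (U : lmodType k) : bilin (fun (x : U) (h : H 0) => heps H h *: x).
  split=> [v e u u'|u e v v'] /=; first by rewrite scalerDr !scalerA mulrC.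
  by rewrite heps_linear scalerDl scalerA.
move: (restr_coact E m).
apply: (tens_ext (f := fun t => sub_val (tlift _ t)) (g := fun t => tlift _ (tmap _ _ t))).
- by apply: lin_comp => //; apply: tlift_linear.
- by apply: (lin_comp (tlift_linear (eb _))); apply: tmap_linear.
by move=> u h; rewrite tmap_tens // !tlift_tens // (linZ (vl a)).
Qed.

Definition restr_comodule : comodule H := Comodule restr_coact_is_comodule.

Lemma support0 : (aone : H 0) <> 0.
Proof.
by move=> h0; have := heps1 H; rewrite h0 (lin0 (@heps_linear _ _ H)) => /eqP; rewrite eq_sym oner_eq0.
Qed.

Lemma supportD c a b : c = a + b -> (aone : H c) = 0 ->
  (aone : H a) = 0 \/ (aone : H b) = 0.
Proof.
move=> E c0; have [dl d1 _] := hdelta_alg H E; apply: tens_eq0.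
by rewrite tens1 -d1 c0 (lin0 dl).
Qed.

Lemma supportN a : (aone : H (- a)) = 0 -> (aone : H a) = 0.
Proof.
move=> b0; have E0 : 0 = a + - a by rewrite subrr.
have Ea : a = - - a by rewrite opprK.
have := @hantir _ _ H _ _ E0 Ea aone; rewrite [hdelta _ _ _](tensor_trivial _ b0).
rewrite heps1 scale1r => <-; apply: lin0; apply: tlift_linear.
by apply: (bilin_lin2 amul_bilin) => // ? ? ?; rewrite linearP.
Qed.

Lemma restr_trivial : trivial_comodule restr_comodule.
Proof.
move=> a x; have [[m mP mx] xi] := sub_valP x; rewrite -mx in xi.
have ni c : (aone : H (a - c)) <> 0 -> S c (m c).
  move=> s; split; first by exists m.
  have E : a = c + (a - c) by rewrite addrCA subrr addr0.
  by have [//|] := lie_inv_descent E mP xi.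
have nex c : exists y : subsp (S c), ((aone : H (a - c)) = 0 -> y = 0) /\
    ((aone : H (a - c)) <> 0 -> sub_val y = m c).
  case: (pselect ((aone : H (a - c)) = 0)) => s.
    by exists 0.
  by exists (sub_in (ni c s)).
have [n nP] : exists n : forall c, subsp (S c), forall c,
    ((aone : H (a - c)) = 0 -> n c = 0) /\
    ((aone : H (a - c)) <> 0 -> sub_val (n c) = m c).
  exists (fun c => projT1 (cid (nex c))) => c; exact: projT2 (cid (nex c)).
exists n; last first.
  apply: sub_val_inj; rewrite (nP a).2 // subrr; exact: support0.
move=> c d b E /=; case: (pselect ((aone : H b) = 0)) => b0.
  by rewrite [LHS]tensor_trivial // [RHS]tensor_trivial.
apply: tmap_sub_inj; rewrite restr_coactE tmap_tens; [|exact: sub_val_linear|exact: lin_id].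
have e1 : a - d = (a - c) + b by rewrite E opprD addrA subrK.
have e2 : a - c = (a - d) + - b by rewrite E opprD addrA.
case: (pselect ((aone : H (a - c)) = 0)) => s.
  have s' : (aone : H (a - d)) = 0.
    by have [//|/supportN] := supportD e2 s.
  rewrite (nP c).1 // (nP d).1 // (lin0 (@sub_val_linear _ _ _)).
  rewrite (lin0 (@sub_val_linear _ _ _)).
  by rewrite (lin0 (coact_linear (comoduleP M) E)) (lin0 ((tens_bilin _ _).1 _)).
have s' : (aone : H (a - d)) <> 0 by move=> /(supportD e1) [].
by rewrite (nP c).2 // (nP d).2.
Qed.
End Restriction.

Record category := Category {
  cobj :> Type;
  chom : cobj -> cobj -> Type;
  cidm : forall x, chom x x;
  ccomp : forall x y z, chom y z -> chom x y -> chom x z;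
  ccomp1m : forall x y (f : chom x y), ccomp (cidm y) f = f;
  ccompm1 : forall x y (f : chom x y), ccomp f (cidm x) = f;
  ccompA : forall x y z w (f : chom z w) (g : chom y z) (h : chom x y),
    ccomp f (ccomp g h) = ccomp (ccomp f g) h
}.
Arguments cidm {c} x : rename.
Arguments ccomp {c x y z} f g : rename.

Record functor (C D : category) := Functor {
  fobj :> C -> D;
  fmap : forall x y : C, chom x y -> chom (fobj x) (fobj y);
  fmap1 : forall x, fmap (cidm x) = cidm (fobj x);
  fmap_comp : forall x y z (f : chom y z) (g : chom x y),
    fmap (ccomp f g) = ccomp (fmap f) (fmap g)
}.
Arguments fmap {C D} F {x y} f : rename.

Definition split_epi (C : category) (x y : C) (f : chom x y) : Prop :=
  exists g : chom y x, ccomp f g = cidm y.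

Definition relative_projective (C D : category) (F : functor C D) (P : C) : Prop :=
  forall (x y : C) (i : chom x y), split_epi (fmap F i) ->
  forall f : chom P y, exists g : chom P x, ccomp i g = f.

Definition dual_maschke (C D : category) (F : functor C D) : Prop :=
  forall P : C, relative_projective F P.

Section Categories.
Variables (k : fieldType) (G : zmodType) (H : hopfGcoalgebra k G).
Variable A : comodPoisson H.

Record poisson_hopf_map (M N : poissonHopfModule A) (f : forall a, M a -> N a) :
    Prop := PoissonHopfMap {
  phm_linear : forall a, linear (f a);
  phm_act : forall a (x : A a) m, f a (pact M x m) = pact N x (f a m);
  phm_lact : forall a (x : A a) m, f a (plact M x m) = plact N x (f a m);
  phm_colinear : colinear (M := M) (N := N) f
}.

Definition poisson_hopf_hom (M N : poissonHopfModule A) : Type :=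
  {f : forall a, M a -> N a | poisson_hopf_map f}.

Lemma colinear_id (M : comodule H) : colinear (M := M) (N := M) (fun a => id).
Proof. by move=> c a b E m; rewrite tmap_id. Qed.

Lemma colinear_comp (M N P : comodule H) (f : forall a, N a -> P a)
    (g : forall a, M a -> N a) :
  (forall a, linear (f a)) -> (forall a, linear (g a)) ->
  colinear (M := N) (N := P) f -> colinear (M := M) (N := N) g ->
  colinear (M := M) (N := P) (fun a x => f a (g a x)).
Proof.
move=> fl gl fc gc c a b E m; rewrite fc gc tmap_comp //; exact: lin_id.
Qed.

Lemma poisson_hopf_id M : poisson_hopf_map (M := M) (N := M) (fun a => id).
Proof. by split=> //; apply: colinear_id. Qed.

Lemma poisson_hopf_comp (M N P : poissonHopfModule A)
    (f : forall a, N a -> P a) (g : forall a, M a -> N a) :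
  poisson_hopf_map f -> poisson_hopf_map g ->
  poisson_hopf_map (M := M) (N := P) (fun a x => f a (g a x)).
Proof.
move=> [fl fa fb fc] [gl ga gb gc]; split=> [a|a x m|a x m|].
- exact: lin_comp.
- by rewrite ga fa.
- by rewrite gb fb.
- exact: colinear_comp.
Qed.

Lemma hom_eq (T : G -> Type) (U : G -> Type) (P : (forall a, T a -> U a) -> Prop)
    (f g : {f : forall a, T a -> U a | P f}) :
  (forall a x, sval f a x = sval g a x) -> f = g.
Proof.
case: f g => [f fP] [g gP] /= fg.
have e : f = g.
  apply: functional_extensionality_dep => a.
  by apply: functional_extensionality_dep => x; apply: fg.
by subst g; rewrite (Prop_irrelevance fP gP).
Qed.

Definition phm_cidm M : poisson_hopf_hom M M := exist _ _ (poisson_hopf_id M).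
Definition phm_comp M N P (f : poisson_hopf_hom N P) (g : poisson_hopf_hom M N) : poisson_hopf_hom M P :=
  exist _ (fun a x => sval f a (sval g a x)) (poisson_hopf_comp (svalP f) (svalP g)).

Lemma phm_comp1m M N (f : poisson_hopf_hom M N) : phm_comp (phm_cidm N) f = f.
Proof. by apply: hom_eq. Qed.
Lemma phm_compm1 M N (f : poisson_hopf_hom M N) : phm_comp f (phm_cidm M) = f.
Proof. by apply: hom_eq. Qed.
Lemma phm_compA M N P Q (f : poisson_hopf_hom P Q) (g : poisson_hopf_hom N P) (h : poisson_hopf_hom M N) :
  phm_comp f (phm_comp g h) = phm_comp (phm_comp f g) h.
Proof. by apply: hom_eq. Qed.

Definition poissonHopfCat : category :=
  Category phm_comp1m phm_compm1 phm_compA.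

Definition coinv_alg (a : G) : Type := subsp (lie_coinv_space (regular A) a).
HB.instance Definition _ a :=
  GRing.Lmodule.on (coinv_alg a).

Definition coinv_alg_val a (x : coinv_alg a) : A a := sub_val x.

Lemma lie_coinv_one a : lie_coinv_space (regular A) a (aone : A a).
Proof.
split.
  exists (fun c => aone : A c) => // c d b E.
  by have [_ e1 _] := acoact_alg A E; rewrite -tens1 in e1; apply: e1.
move=> p; have := pbracket_leibniz p aone aone.
rewrite !amulx1 amul1x => e; apply: (addrI (pbracket p aone)).
by rewrite addr0; exact: esym e.
Qed.

Lemma lie_coinv_act (M : poissonHopfModule A) a (x : A a) (m : M a) :
  lie_coinv_space (regular A) a x -> lie_coinv_space M a m ->
  lie_coinv_space M a (pact M x m).
Proof.
move=> [[y yP <-] xi] [[n nP <-] mi]; split.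
  exists (fun c => pact M (y c : A c) (n c)) => // c d b E.
  have := yP c d b E; rewrite /= => e.
  rewrite pcoact_act e nP (tmap2_tens (act_bilin (pactP M d)) amul_bilin).
  by rewrite amulx1.
move=> p; have := xi p; rewrite /= => pe; rewrite plact_act pe mi.
have [al ar] := act_bilin (pactP M a).
by rewrite (lin0 (al _)) (lin0 (ar _)) addr0.
Qed.

Definition coinv_alg_mul a (x y : coinv_alg a) : coinv_alg a :=
  sub_in (lie_coinv_act (M := regular A) (sub_valP x) (sub_valP y)).
Definition coinv_alg_one a : coinv_alg a := sub_in (lie_coinv_one a).

Lemma coinv_alg_mul_bilin a : bilin (@coinv_alg_mul a).
Proof.
have [l r] := amul_bilin (s := A a).
split=> [y c x x'|x c y y']; apply: sub_val_inj; rewrite sub_val_linear !sub_inK.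
  by rewrite (sub_val_linear (S := lie_coinv_space (regular A) a)); apply: l.
by rewrite (sub_val_linear (S := lie_coinv_space (regular A) a)); apply: r.
Qed.
Lemma coinv_alg_mulA a : associative (@coinv_alg_mul a).
Proof. by move=> x y z; apply: sub_val_inj; apply: (@amulA _ (A a)). Qed.
Lemma coinv_alg_mul1x a : left_id (@coinv_alg_one a) (@coinv_alg_mul a).
Proof. by move=> x; apply: sub_val_inj; apply: (@amul1x _ (A a)). Qed.
Lemma coinv_alg_mulx1 a : right_id (@coinv_alg_one a) (@coinv_alg_mul a).
Proof. by move=> x; apply: sub_val_inj; apply: (@amulx1 _ (A a)). Qed.
HB.instance Definition _ a := isPzAlgebra.Build k (coinv_alg a)
  (@coinv_alg_mul_bilin a) (@coinv_alg_mulA a) (@coinv_alg_mul1x a)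
  (@coinv_alg_mulx1 a).

Record trivModule := TrivModule {
  tcomod :> comodule H;
  tact : forall a, coinv_alg a -> tcomod a -> tcomod a;
  tactP : forall a, is_module (tact (a := a));
  tcomod_trivial : trivial_comodule tcomod
}.

Record triv_map (M N : trivModule) (f : forall a, M a -> N a) : Prop :=
  TrivMap {
  tm_linear : forall a, linear (f a);
  tm_act : forall a (x : coinv_alg a) m, f a (tact x m) = tact x (f a m);
  tm_colinear : colinear (M := M) (N := N) f
}.

Definition triv_hom (M N : trivModule) : Type :=
  {f : forall a, M a -> N a | triv_map f}.

Lemma triv_id M : triv_map (M := M) (N := M) (fun a => id).
Proof. by split=> //; apply: colinear_id. Qed.

Lemma triv_comp (M N P : trivModule)
    (f : forall a, N a -> P a) (g : forall a, M a -> N a) :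
  triv_map f -> triv_map g ->
  triv_map (M := M) (N := P) (fun a x => f a (g a x)).
Proof.
move=> [fl fa fc] [gl ga gc]; split=> [a|a x m|].
- exact: lin_comp.
- by rewrite ga fa.
- exact: colinear_comp.
Qed.

Definition tm_cidm M : triv_hom M M := exist _ _ (triv_id M).
Definition tm_comp M N P (f : triv_hom N P) (g : triv_hom M N) : triv_hom M P :=
  exist _ (fun a x => sval f a (sval g a x)) (triv_comp (svalP f) (svalP g)).

Lemma tm_comp1m M N (f : triv_hom M N) : tm_comp (tm_cidm N) f = f.
Proof. by apply: hom_eq. Qed.
Lemma tm_compm1 M N (f : triv_hom M N) : tm_comp f (tm_cidm M) = f.
Proof. by apply: hom_eq. Qed.
Lemma tm_compA M N P Q (f : triv_hom P Q) (g : triv_hom N P) (h : triv_hom M N) :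
  tm_comp f (tm_comp g h) = tm_comp (tm_comp f g) h.
Proof. by apply: hom_eq. Qed.

Definition trivCat : category :=
  Category tm_comp1m tm_compm1 tm_compA.

Definition restr_act (M : poissonHopfModule A) a (x : coinv_alg a)
    (m : restr_comodule M a) : restr_comodule M a :=
  sub_in (lie_coinv_act (sub_valP x) (sub_valP m)).

Lemma restr_act_module M a : is_module (@restr_act M a).
Proof.
have vl := sub_val_linear (S := lie_coinv_space M a).
have al := act_bilin (pactP M a).
split=> [|m|x y m]; last 2 first.
- by apply: sub_val_inj; apply: act1 (pactP M a) _.
- by apply: sub_val_inj; apply: actM (pactP M a) _ _ _.
split=> [m c x y|x c m n]; apply: sub_val_inj; rewrite vl !sub_inK.
  by rewrite (sub_val_linear (S := lie_coinv_space (regular A) a)); apply: al.1.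
by rewrite vl; apply: al.2.
Qed.

Definition F1_obj (M : poissonHopfModule A) : trivModule :=
  TrivModule (restr_act_module M) (restr_trivial (M := M)).

Lemma lie_coinv_map (M N : poissonHopfModule A) (f : forall a, M a -> N a) a m :
  poisson_hopf_map f -> lie_coinv_space M a m -> lie_coinv_space N a (f a m).
Proof.
move=> [fl fa fb fc] [[n nP <-] mi]; split.
  exists (fun c => f c (n c)) => // c d b E; rewrite fc nP.
  by rewrite tmap_tens //; apply: lin_id.
by move=> p; rewrite -fb mi (lin0 (fl a)).
Qed.

Definition F1_map (M N : poissonHopfModule A) (f : poisson_hopf_hom M N) a
    (m : F1_obj M a) : F1_obj N a :=
  sub_in (lie_coinv_map (svalP f) (sub_valP m)).

Lemma F1_mapP (M N : poissonHopfModule A) (f : poisson_hopf_hom M N) :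
  triv_map (F1_map f).
Proof.
have [fl fa fb fc] := svalP f.
have vl (P : poissonHopfModule A) a := sub_val_linear (S := lie_coinv_space P a).
have Fl a : linear (F1_map f (a := a)).
  by move=> c x y; apply: sub_val_inj; rewrite vl !sub_inK vl fl.
split=> // [a x m|c a b E m]; first by apply: sub_val_inj; apply: fa.
apply: tmap_sub_inj; rewrite restr_coactE.
rewrite (tmap_comp _ (Fl a) (@lin_id _ _) (vl N a) (@lin_id _ _)).
rewrite sub_inK fc -restr_coactE.
by rewrite (tmap_comp _ (vl M a) (@lin_id _ _) (fl a) (@lin_id _ _)).
Qed.

Definition F1_hom (M N : poissonHopfModule A) (f : poisson_hopf_hom M N) :
  triv_hom (F1_obj M) (F1_obj N) := exist _ (F1_map f) (F1_mapP f).

Lemma F1_hom1 M : F1_hom (phm_cidm M) = tm_cidm (F1_obj M).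
Proof. by apply: hom_eq => a x; apply: sub_val_inj. Qed.
Lemma F1_hom_comp M N P (f : poisson_hopf_hom N P) (g : poisson_hopf_hom M N) :
  F1_hom (phm_comp f g) = tm_comp (F1_hom f) (F1_hom g).
Proof. by apply: hom_eq => a x; apply: sub_val_inj. Qed.

Definition F1 : functor poissonHopfCat trivCat :=
  @Functor poissonHopfCat trivCat F1_obj F1_hom F1_hom1 F1_hom_comp.

Record colinear_algebra_map_center (phi : forall a, H a -> A a) : Prop :=
  ColinearAlgebraMapCenter {
  phi_algebra_map : forall a, algebra_map (phi a);
  phi_center : forall a h, lie_inv (M := regular A) (phi a h);
  phi_colinear : colinear (M := hopf_comodule H) (N := poisson_comodule A) phi
}.

Variable phi : forall a, H a -> A a.

(* p^M_a(m) = phi_a(S_a^{-1}(m_(1,-a))) . m_(0,a) *)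
Definition coinv_proj (M : poissonHopfModule A) (a : G) (m : M 0) : M a :=
  tlift (fun x h => pact M (phi (hanti_inv h)) x)
    (coact M (esym (subrr a) : 0 = a + - a) m).

(* The graph of the action <>' of the Lie algebra A_e on M^{coH}_a:
   y is a value of p <>' x when y = p^M_a(p <> m) for some m in M_e with
   p^M_a(m) = x. *)
Definition diamond' (M : poissonHopfModule A) (a : G) (p : A 0) (x y : M a) : Prop :=
  exists2 m : M 0, coinv_proj a m = x & coinv_proj a (plact M p m) = y.

Definition trivial_lie_coinv (M : poissonHopfModule A) : Prop :=
  forall (p : A 0) (a : G) (x y : M a), coinv x -> diamond' p x y -> y = 0.
End Categories.

(* Main.v *)
(* Put p(m) = phi(S^-1(m_1)) . m_0 for the projection of M_e onto M^{coH}; every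
   m in M_a satisfies m = phi(m_1) . p(m_0). Applied to x <> m this reads
   x <> m = phi(x_1 m_1) . p(x_0 <> m_0) = phi(x_1 m_1) . (x_0 <>' p(m_0)) = 0, so
   the Lie action of A on every Hopf module vanishes and M^{AcoH} = M^{coH}
   contains the image of p. If j is a section of F_1(i), then
   m |-> phi(m_1) . j(p(m_0)) is therefore a section of i; it is A-linear because
   A is commutative and p(x . m) = p(x) . p(m). *)
Require Import Defs.
From mathcomp Require Import all_boot all_order all_algebra.
From mathcomp Require Import boolp classical_sets.

Set Implicit Arguments.
Unset Strict Implicit.
Unset Printing Implicit Defensive.
Import GRing.Theory.
Local Open Scope ring_scope.

(* A Sweedler sum over t; independent of the formal sum representing t only when
   F is bilinear. *)
Notation "\tsum_ ( u , v <- t ) F" := (tlift (fun u v => F) t)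
  (at level 41, u name, v name, t at level 41, F at level 41,
   format "\tsum_ ( u , v  <-  t )  F") : ring_scope.

(** * Calculus of Sweedler sums over a tensor *)

Section TensorSums.
Variable k : fieldType.
Implicit Types U V W X : lmodType k.

Lemma tlift_ext U V W (F F' : U -> V -> W) t :
  (forall u v, F u v = F' u v) -> tlift F t = tlift F' t.
Proof. by move=> FF'; apply: eq_bigr => p _; apply: FF'. Qed.

Lemma lin_sum W X (g : W -> X) I (r : seq I) (F : I -> W) :
  linear g -> g (\sum_(i <- r) F i) = \sum_(i <- r) g (F i).
Proof.
move=> gl; elim: r => [|i r IH]; first by rewrite !big_nil (lin0 gl).
by rewrite !big_cons (linD gl) IH.
Qed.

Lemma lin_tlift U V W X (g : W -> X) (F : U -> V -> W) t :
  linear g -> g (\tsum_(u, v <- t) F u v) = \tsum_(u, v <- t) g (F u v).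
Proof. exact: lin_sum. Qed.

(** Each [tlift] is a finite sum over the chosen representative of its tensor, so this is the
    exchange of two finite sums. *)
Lemma tlift_exchange U V U' V' W (F : U -> V -> U' -> V' -> W) t t' :
  \tsum_(u, v <- t) \tsum_(u', v' <- t') F u v u' v'
  = \tsum_(u', v' <- t') \tsum_(u, v <- t) F u v u' v'.
Proof. exact: exchange_big. Qed.

Lemma tensK U V (t : tensor U V) : \tsum_(u, v <- t) tens u v = t.
Proof. exact: esym (tensE t). Qed.

Lemma lin_appl U V W X (f : U -> V -> W) (g : X -> U) c :
  bilin f -> linear g -> linear (fun x => f (g x) c).
Proof. by move=> [fl _]; apply: (lin_comp (f := f^~ c)). Qed.

Lemma lin_appr U V W X (f : U -> V -> W) (g : X -> V) c :
  bilin f -> linear g -> linear (fun x => f c (g x)).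
Proof. by move=> [_ fr]; apply: (lin_comp (f := f c)). Qed.

Lemma lin_tliftl U V W X (F : X -> U -> V -> W) t :
  (forall u v, linear (fun x => F x u v)) ->
  linear (fun x => \tsum_(u, v <- t) F x u v).
Proof.
move=> Fl c x y; rewrite /tlift scaler_sumr -big_split /=.
by apply: eq_bigr => p _; apply: Fl.
Qed.

Lemma lin_tliftr U V W X (F : U -> V -> W) (g : X -> tensor U V) :
  bilin F -> linear g -> linear (fun x => tlift F (g x)).
Proof. by move=> Fb; apply: lin_comp; apply: tlift_linear. Qed.

Lemma lin_scale W X (g : X -> W) c : linear g -> linear (fun x => c *: g x).
Proof. by move=> gl a x y; rewrite gl scalerDr !scalerA mulrC. Qed.

Lemma lin_scalel W X (g : X -> k^o) (w : W) :
  linear g -> linear (fun x => (g x : k) *: w).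
Proof. by move=> gl a x y; rewrite gl scalerDl scalerA. Qed.

End TensorSums.

(** * Automation for linearity and bilinearity side conditions *)

Ltac bilin_head := lazymatch goal with
  | |- bilin (@amul _ _) => exact: amul_bilin
  | |- bilin (@tens _ _ _) => exact: tens_bilin
  | |- bilin (@pact _ _ _ _ ?M ?a) => exact: (act_bilin (pactP M a))
  | |- _ => assumption
  end.
Ltac linear_hyp := match goal with
  | h : context [GRing.linear_for] |- GRing.linear_for _ _ => solve [apply h]
  end.
Ltac linear_head := lazymatch goal with
  | |- GRing.linear_for _ (@coact _ _ _ ?M _ _ _ _) =>
      exact: (coact_linear (comoduleP M))
  | |- GRing.linear_for _ (GRing.Linear.sort _) => exact: linearP
  | |- _ => linear_hyp
  end.

(* Backtracking is needed: in the patterns below ?F, ?t and ?c may capture the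
   bound variable, in which case the lemma does not apply. *)
Ltac lin := cbv beta; first [linear_hyp | match goal with
  | |- bilin _ => first [bilin_head | split; intro; lin]
  | |- GRing.linear_for _ (tlift _) => apply: tlift_linear; lin
  | |- GRing.linear_for _ (fun x => x) => exact: lin_id
  | |- GRing.linear_for _ (fun x => tlift ?F (@?g x)) =>
      apply: lin_tliftr; lin
  | |- GRing.linear_for _ (fun x => tlift (@?F x) ?t) =>
      apply: lin_tliftl; intros ? ?; lin
  | |- GRing.linear_for _ (fun x => ?c *: (@?g x)) =>
      apply: lin_scale; lin
  | |- GRing.linear_for _ (fun x => heps ?H (@?g x) *: ?c) =>
      apply: (lin_scalel (g := fun x => heps H (g x)));
      apply: (lin_comp (f := heps H : _ -> _^o)); lin
  | |- GRing.linear_for _ (fun x => ?f (@?g x) ?c) =>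
      apply: (lin_appl (f := f)); lin
  | |- GRing.linear_for _ (fun x => ?f ?c (@?g x)) =>
      apply: (lin_appr (f := f)); [bilin_head | lin]
  | |- GRing.linear_for _ (fun x => ?f (@?g x)) =>
      apply: (lin_comp (f := f)); [linear_head | lin]
  | |- GRing.linear_for _ ?f => linear_head
  | |- GRing.linear_for _ (?f ?c) =>
      apply: (lin_appr (f := f) (g := id)); [bilin_head | exact: lin_id]
  | |- forall _, _ => intro; lin
  end].

(** * Sweedler sums over images of tensor maps *)

Section TensorMapSums.
Variable k : fieldType.
Implicit Types U V W X : lmodType k.

Lemma tlift_tmap U V U' V' W (F : U' -> V' -> W) (f : U -> U') (g : V -> V') t :
  bilin F -> linear f -> linear g ->
  tlift F (tmap f g t) = \tsum_(u, v <- t) F (f u) (g v).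
Proof.
move=> Fb fl gl; rewrite /tmap (lin_tlift _ _ (tlift_linear Fb)).
by apply: tlift_ext => u v; rewrite tlift_tens.
Qed.

Lemma tlift_tmap2 U V U' V' U'' V'' W (F : U'' -> V'' -> W)
    (f : U -> U' -> U'') (g : V -> V' -> V'') s t : bilin F ->
  tlift F (tmap2 f g s t)
  = \tsum_(u, v <- s) \tsum_(u', v' <- t) F (f u u') (g v v').
Proof.
move=> Fb; have Fl := tlift_linear Fb; rewrite /tmap2 (lin_tlift _ _ Fl).
apply: tlift_ext => u v; rewrite (lin_tlift _ _ Fl).
by apply: tlift_ext => u' v'; rewrite tlift_tens.
Qed.

Lemma tmap2_tliftl (U V U' V' U'' V'' X Y : lmodType k) (f : U -> U' -> U'')
    (g : V -> V' -> V'') (F : X -> Y -> tensor U V) s t : bilin f -> bilin g ->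
  tmap2 f g (\tsum_(x, y <- s) F x y) t = \tsum_(x, y <- s) tmap2 f g (F x y) t.
Proof.
by move=> fb gb; rewrite (lin_tlift _ _ ((tmap2_bilin fb gb).1 t)).
Qed.

Lemma tmap2_tensl (U V U' V' U'' V'' : lmodType k) (f : U -> U' -> U'')
    (g : V -> V' -> V'') u v t : bilin f -> bilin g ->
  tmap2 f g (tens u v) t = \tsum_(u', v' <- t) tens (f u u') (g v v').
Proof. by move=> fb gb; rewrite /tmap2 (tlift_tens (tmap2_bilin1 fb gb t)). Qed.

Lemma amulZl (R : pzAlgType k) c (x y : R) : (c *: x) ** y = c *: (x ** y).
Proof. exact: (linZ (amul_bilin.1 y)). Qed.
Lemma amulZr (R : pzAlgType k) c (x y : R) : x ** (c *: y) = c *: (x ** y).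
Proof. exact: (linZ (amul_bilin.2 x)). Qed.
Lemma amul_tliftl (R : pzAlgType k) (U V : lmodType k) (F : U -> V -> R) t y :
  (\tsum_(u, v <- t) F u v) ** y = \tsum_(u, v <- t) F u v ** y.
Proof. exact: (lin_tlift _ _ (amul_bilin.1 y)). Qed.
Lemma amul_tliftr (R : pzAlgType k) (U V : lmodType k) (F : U -> V -> R) t x :
  x ** (\tsum_(u, v <- t) F u v) = \tsum_(u, v <- t) x ** F u v.
Proof. exact: (lin_tlift _ _ (amul_bilin.2 x)). Qed.
End TensorMapSums.

(** * Coassociativity and counit in Sweedler form *)

Section Comodules.
Variables (k : fieldType) (G : zmodType) (H : hopfGcoalgebra k G).

(** Linearity in each argument makes [F] descend to M_a (x) (H_b (x) H_c), so the comodule axiom, an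
    identity of tensors, becomes a rewriting rule under Sweedler sums. *)
Lemma coact_assoc (M : comodule H) a b c ab bc abc (Eab : ab = a + b)
    (Eabc : abc = ab + c) (Ebc : bc = b + c) (Eabc' : abc = a + bc)
    (W : lmodType k) (F : M a -> H b -> H c -> W) m :
  (forall u v, linear (F u v)) -> (forall u w, linear (fun v => F u v w)) ->
  (forall v w, linear (fun u => F u v w)) ->
  \tsum_(x, w <- coact M Eabc m) \tsum_(u, v <- coact M Eab x) F u v w
  = \tsum_(u, y <- coact M Eabc' m) \tsum_(v, w <- hdelta H Ebc y) F u v w.
Proof.
move=> F3 F2 F1.
pose Phi u := tlift (F u).
have Phib : bilin Phi by rewrite /Phi; lin.
have := congr1 (tlift Phi) (coact_coassoc (comoduleP M) Eab Eabc Ebc Eabc' m).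
rewrite tlift_tmap; [move=> ->|lin..].
rewrite /tassoc (lin_tlift _ _ (tlift_linear Phib)) tlift_tmap; [|lin..].
apply: tlift_ext => x w; rewrite (lin_tlift _ _ (tlift_linear Phib)).
by apply: tlift_ext => u v; rewrite tlift_tens // /Phi tlift_tens //; lin.
Qed.

Lemma coact_counitr (M : comodule H) a (E : a = a + 0) (W : lmodType k)
    (f : M a -> W) m : linear f ->
  \tsum_(x, h <- coact M E m) heps H h *: f x = f m.
Proof.
move=> fl; rewrite -[RHS](congr1 f (coact_counit (comoduleP M) E m)).
by rewrite lin_tlift //; apply: tlift_ext => x h; rewrite (linZ fl).
Qed.
End Comodules.

(** * The antipode reverses products and coproducts *)

Section HopfSums.
Variables (k : fieldType) (G : zmodType) (H : hopfGcoalgebra k G).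

Lemma delta_assoc a b c ab bc abc (Eab : ab = a + b)
    (Eabc : abc = ab + c) (Ebc : bc = b + c) (Eabc' : abc = a + bc)
    (W : lmodType k) (F : H a -> H b -> H c -> W) h :
  (forall u v, linear (F u v)) -> (forall u w, linear (fun v => F u v w)) ->
  (forall v w, linear (fun u => F u v w)) ->
  \tsum_(x, w <- hdelta H Eabc h) \tsum_(u, v <- hdelta H Eab x) F u v w
  = \tsum_(u, y <- hdelta H Eabc' h) \tsum_(v, w <- hdelta H Ebc y) F u v w.
Proof. exact: (@coact_assoc _ _ _ (hopf_comodule H)). Qed.

Lemma delta_counitr a (E : a = a + 0) (W : lmodType k) (f : H a -> W) h :
  linear f -> \tsum_(x, y <- hdelta H E h) heps H y *: f x = f h.
Proof. exact: (@coact_counitr _ _ _ (hopf_comodule H)). Qed.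

Lemma delta_counitl a (E : a = 0 + a) (W : lmodType k) (f : H a -> W) h :
  linear f -> \tsum_(x, y <- hdelta H E h) heps H x *: f y = f h.
Proof.
move=> fl; rewrite -[RHS](congr1 f (hcounitl E h)).
by rewrite lin_tlift //; apply: tlift_ext => x y; rewrite (linZ fl).
Qed.

Lemma tlift_deltaM (W : lmodType k) c a b (E : c = a + b) (x y : H c)
    (F : H a -> H b -> W) : bilin F ->
  tlift F (hdelta H E (x ** y)) = \tsum_(x1, x2 <- hdelta H E x)
    \tsum_(y1, y2 <- hdelta H E y) F (x1 ** y1) (x2 ** y2).
Proof.
by move=> Fb; have [_ _ ->] := hdelta_alg H E; rewrite -tlift_tmap2.
Qed.

(** Both sides equal the sum of S(x_1 y_1) x_2 y_2 S(y_3): contracting y_2 S(y_3) to the counit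
    gives the left side, contracting S(x_1 y_1) x_2 y_2 gives the right. *)
Lemma hanti_shift a a' (E : 0 = a + a') (E' : a' = - a) (x : H 0) (y : H a) :
  \tsum_(x1, x2 <- hdelta H E x) hanti H E' (x1 ** y) ** x2
  = heps H x *: hanti H E' y.
Proof.
have Ea0 : a = a + 0 by rewrite addr0.
have E0a : a = 0 + a by rewrite add0r.
have Ea'a : 0 = a' + a by rewrite addrC.
transitivity (\tsum_(x1, x2 <- hdelta H E x) \tsum_(u, v <- hdelta H E0a y)
    \tsum_(y1, y2 <- hdelta H E u)
      hanti H E' (x1 ** y1) ** x2 ** y2 ** hanti H E' v); last first.
  rewrite -(delta_counitl E0a (f := fun y => heps H x *: hanti H E' y)); last by lin.
  rewrite tlift_exchange.
  apply: tlift_ext => u v; rewrite scalerA mulrC -hepsM -[in RHS](amul1x (hanti H E' v)).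
  rewrite -amulZl -(hantil E E') tlift_deltaM; [|lin].
  rewrite amul_tliftl; apply: tlift_ext => x1 x2.
  by rewrite amul_tliftl; apply: tlift_ext => y1 y2; rewrite amulA.
apply: tlift_ext => x1 x2.
rewrite (delta_assoc (F := fun y1 y2 v =>
  hanti H E' (x1 ** y1) ** x2 ** y2 ** hanti H E' v) E E0a Ea'a Ea0); [|lin..].
rewrite -(delta_counitr Ea0 (f := fun y => hanti H E' (x1 ** y) ** x2)); last by lin.
apply: tlift_ext => u v; rewrite -[in LHS](amulx1 (hanti H E' (x1 ** u) ** x2)) -amulZr.
rewrite -(hantir Ea'a E') amul_tliftr.
by apply: tlift_ext => y1 y2; rewrite amulA.
Qed.

(** The sum of S(x_1 y) x_2 S(x_3) is evaluated in two ways: contracting x_2 S(x_3) leaves S(xy),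
    while [hanti_shift] turns S(x_1 y) x_2 into S(y) and leaves S(y) S(x). *)
Lemma hantiM a a' (E' : a' = - a) (x y : H a) :
  hanti H E' (x ** y) = hanti H E' y ** hanti H E' x.
Proof.
have Ea0 : a = a + 0 by rewrite addr0.
have E0a : a = 0 + a by rewrite add0r.
have E : 0 = a + a' by rewrite E' subrr.
have Ea'a : 0 = a' + a by rewrite addrC.
transitivity (\tsum_(u, v <- hdelta H E0a x) \tsum_(x1, x2 <- hdelta H E u)
    hanti H E' (x1 ** y) ** x2 ** hanti H E' v); last first.
  rewrite -(delta_counitl E0a (f := fun x => hanti H E' y ** hanti H E' x)); last by lin.
  apply: tlift_ext => u v.
  by rewrite -amul_tliftl (hanti_shift E E' u y) amulZl.
rewrite (delta_assoc (F := fun x1 x2 v =>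
  hanti H E' (x1 ** y) ** x2 ** hanti H E' v) E E0a Ea'a Ea0); [|lin..].
rewrite -(delta_counitr Ea0 (f := fun x => hanti H E' (x ** y))); last by lin.
apply: tlift_ext => u v; rewrite -[in LHS](amulx1 (hanti H E' (u ** y))) -amulZr.
rewrite -(hantir Ea'a E') amul_tliftr.
by apply: tlift_ext => y1 y2; rewrite amulA.
Qed.

Lemma delta1 c a b (E : c = a + b) : hdelta H E aone = tens aone aone.
Proof. by have [_ -> _] := hdelta_alg H E. Qed.

Lemma hanti1 a a' (E' : a' = - a) : hanti H E' aone = aone.
Proof.
have E : 0 = a + a' by rewrite E' subrr.
have := @hantil _ _ H _ _ E E' aone; rewrite delta1 tlift_tens; last by lin.
by rewrite amulx1 heps1 scale1r.
Qed.

(* h |-> S(h_2) (x) S(h_1) is a right convolution inverse of Delta; since Delta S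
   is a left one, the two agree. *)
Lemma delta_hanti_convol a b c a' b' c' (Ea : a' = - a) (Eb : b' = - b)
    (Ec : c' = - c) (E : c = a + b) (E' : c' = b' + a') (E0 : 0 = c' + c) h :
  \tsum_(x, y <- hdelta H E0 h) hdelta H E' x **
    (\tsum_(u, v <- hdelta H E y) tens (hanti H Eb v) (hanti H Ea u))
  = heps H h *: aone.
Proof.
have E1 : 0 = b' + b by rewrite Eb addNr.
have E2 : b = a' + c by rewrite E Ea addKr.
have E3 : b = 0 + b by rewrite add0r.
have E4 : 0 = a' + a by rewrite Ea addNr.
pose N y := \tsum_(u, v <- hdelta H E y) tens (hanti H Eb v) (hanti H Ea u).
transitivity (\tsum_(x, y <- hdelta H E0 h) \tsum_(x1, x2 <- hdelta H E' x)
    tens x1 x2 ** N y).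
  apply: tlift_ext => x y; rewrite -amul_tliftl; congr (_ ** _).
  exact: esym (tensK _).
rewrite (delta_assoc (F := fun x1 x2 y => tens x1 x2 ** N y)
  E' E0 E2 E1); [|rewrite /N; lin..].
(* The two middle legs of [h] are contracted first, by the antipode axiom in the second tensor
   factor; the two outer legs then contract in the first factor. *)
transitivity (\tsum_(x, y <- hdelta H E1 h) tens (x ** hanti H Eb y) (aone : H a')).
  apply: tlift_ext => x z.
  rewrite -(delta_counitl E3 (f := fun z => tens (x ** hanti H Eb z) aone)); last by lin.
  transitivity (\tsum_(x2, y <- hdelta H E2 z) \tsum_(u, v <- hdelta H E y)
      tens (x ** hanti H Eb v) (x2 ** hanti H Ea u)).
    apply: tlift_ext => x2 y; rewrite /N amul_tliftr.
    by apply: tlift_ext => u v; rewrite tensM.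
  rewrite -(delta_assoc (F := fun x2 u v =>
    tens (x ** hanti H Eb v) (x2 ** hanti H Ea u)) E4 E3 E E2); [|lin..].
  apply: tlift_ext => w v.
  rewrite -(lin_tlift _ _ ((tens_bilin _ _).2 _)) (hantir E4 Ea).
  by rewrite (linZ ((tens_bilin _ _).2 _)).
rewrite -(lin_tlift _ _ ((tens_bilin _ _).1 _)) (hantir E1 Eb).
by rewrite (linZ ((tens_bilin _ _).1 _)).
Qed.

(** Uniqueness of convolution inverses: in the sum of D(S(h_1)) D(h_2) N(h_3), the first two factors
    contract because D is an algebra map, leaving N(h), and the last two by [delta_hanti_convol],
    leaving D(S(h)). *)
Lemma delta_hanti a b c a' b' c' (Ea : a' = - a) (Eb : b' = - b)
    (Ec : c' = - c) (E : c = a + b) (E' : c' = b' + a') h :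
  hdelta H E' (hanti H Ec h)
  = \tsum_(u, v <- hdelta H E h) tens (hanti H Eb v) (hanti H Ea u).
Proof.
have E0 : 0 = c' + c by rewrite Ec addNr.
have E0' : 0 = c + c' by rewrite addrC.
have Ec0 : c = c + 0 by rewrite addr0.
have E0c : c = 0 + c by rewrite add0r.
pose D x := hdelta H E' x.
pose N y := \tsum_(u, v <- hdelta H E y) tens (hanti H Eb v) (hanti H Ea u).
transitivity (\tsum_(u, v <- hdelta H E0c h) \tsum_(h1, x <- hdelta H E0' u)
    D (hanti H Ec h1) ** D x ** N v); last first.
  rewrite -[RHS]/(N h) -(delta_counitl E0c (f := N)); last by rewrite /N; lin.
  apply: tlift_ext => u v; rewrite -amul_tliftl -[in RHS](amul1x (N v)) -amulZl.
  congr (_ ** _).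
  have [Dl D1 DM] := hdelta_alg H E'.
  rewrite -D1 -(linZ Dl) -(hantil E0' Ec) (lin_tlift _ _ Dl).
  by apply: tlift_ext => h1 x; rewrite DM.
rewrite (delta_assoc (F := fun h1 x v => D (hanti H Ec h1) ** D x ** N v)
  E0' E0c E0 Ec0); [|rewrite /N /D; lin..].
rewrite -[LHS]/(D (hanti H Ec h)).
rewrite -[LHS](delta_counitr Ec0 (f := fun h => D (hanti H Ec h))); last first.
  by rewrite /D; lin.
apply: tlift_ext => u v; rewrite -[in LHS](amulx1 (D _)) -amulZr.
rewrite -(delta_hanti_convol Ea Eb Ec E E' E0) amul_tliftr.
by apply: tlift_ext => x y; rewrite amulA.
Qed.
End HopfSums.

(** * The inverse antipode *)

Section AntipodeInverse.
Variables (k : fieldType) (G : zmodType) (H : hopfGcoalgebra k G).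
Hypothesis hS : bijective_antipode H.

Lemma hanti_invK a (h : H (- a)) : hanti H (erefl (- a)) (hanti_inv h) = h.
Proof.
(* The default value of [xget] is never taken, since surjectivity supplies a preimage. *)
rewrite /hanti_inv; case: xgetP => [x _ //|nex].
by have [S' _ SK] := hS (erefl (- a)); case: (nex (S' h)); apply: SK.
Qed.

Lemma hantiK a (x : H a) : hanti_inv (hanti H (erefl (- a)) x) = x.
Proof. exact: (bij_inj (hS (erefl (- a)))) (hanti_invK _). Qed.

Lemma hanti_inv_linear a : linear (@hanti_inv _ _ H a).
Proof.
move=> c x y; apply: (bij_inj (hS (erefl (- a)))).
by rewrite linearP !hanti_invK.
Qed.

Lemma hanti_invM a (x y : H (- a)) :
  hanti_inv (x ** y) = hanti_inv y ** hanti_inv x.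
Proof.
by apply: (bij_inj (hS (erefl (- a)))); rewrite hantiM !hanti_invK.
Qed.

(** Applying the injective S reverses the product and turns the summand into x S(y), which is the
    antipode axiom; this explains the flipped order of the two legs. *)
Lemma hanti_inv_mull a (E : 0 = - a + a) h :
  \tsum_(x, y <- hdelta H E h) y ** hanti_inv x = heps H h *: aone.
Proof.
apply: (bij_inj (hS (erefl (- a)))); rewrite (linZ (@linearP _ _ _ _ _)) hanti1.
rewrite -(hantir E (erefl (- a))) lin_tlift; last by lin.
by apply: tlift_ext => x y; rewrite hantiM hanti_invK.
Qed.

Lemma hanti_inv_mulr a (E : 0 = a + - a) h :
  \tsum_(x, y <- hdelta H E h) hanti_inv y ** x = heps H h *: aone.
Proof.
apply: (bij_inj (hS (erefl (- a)))); rewrite (linZ (@linearP _ _ _ _ _)) hanti1.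
rewrite -(hantil E (erefl (- a))) lin_tlift; last by lin.
by apply: tlift_ext => x y; rewrite hantiM hanti_invK.
Qed.

Lemma delta_hanti_inv a b c (E : c = a + b) (E' : - c = - b + - a) h :
  hdelta H E (hanti_inv h)
  = \tsum_(u, v <- hdelta H E' h) tens (hanti_inv v) (hanti_inv u).
Proof.
(* Writing [h] on the right as S of its preimage lets [delta_hanti] expand the coproduct, after
   which S and its inverse cancel on each leg. *)
have Tl := hanti_inv_linear; rewrite -{2}(hanti_invK h).
rewrite (delta_hanti (erefl (- a)) (erefl (- b)) (erefl (- c)) E).
rewrite lin_tlift; last by lin.
rewrite -[LHS]tensK; apply: tlift_ext => x y.
by rewrite tlift_tens ?hantiK //; lin.
Qed.
End AntipodeInverse.

(** * The projection onto coinvariants *)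

Section Projection.
Variables (k : fieldType) (G : zmodType) (H : hopfGcoalgebra k G).
Hypothesis hS : bijective_antipode H.
Variables (A : comodPoisson H) (phi : forall a, H a -> A a).
Hypothesis hphi : colinear_algebra_map_center phi.

Let Tl := hanti_inv_linear hS.

Lemma phi_linear a : linear (phi (a := a)).
Proof. by have [] := phi_algebra_map hphi a. Qed.
Let phil := phi_linear.

Lemma phi1 a : phi (aone : H a) = aone.
Proof. by have [] := phi_algebra_map hphi a. Qed.

Lemma phiM a (x y : H a) : phi (x ** y) = phi x ** phi y.
Proof. by have [_ _ ->] := phi_algebra_map hphi a. Qed.

Lemma acoact_phi a b c (E : c = a + b) h :
  acoact A E (phi h) = \tsum_(x, y <- hdelta H E h) tens (phi x) y.
Proof. exact: (phi_colinear hphi E h). Qed.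

Lemma coinv_proj_linear (M : poissonHopfModule A) a :
  linear (coinv_proj phi a : M 0 -> M a).
Proof. by rewrite /coinv_proj; lin. Qed.

Lemma coact_phi_act (M : poissonHopfModule A) a b c (E : c = a + b) h (m : M c) :
  coact M E (pact M (phi h) m) = \tsum_(x, y <- hdelta H E h)
    \tsum_(m0, m1 <- coact M E m) tens (pact M (phi x) m0) (y ** m1).
Proof.
rewrite pcoact_act acoact_phi tmap2_tliftl; [|lin..].
by apply: tlift_ext => x y; rewrite tmap2_tensl //; lin.
Qed.

(** As S^-1 reverses coproducts, the coaction produces phi(S^-1(m_3)) . m_0 (x) S^-1(m_2) m_1. The
    adjacent legs m_1, m_2 contract to the counit by [hanti_inv_mulr], and what remains is p(m) (x)
    1. *)
Lemma coact_coinv_proj (M : poissonHopfModule A) a b c (E : c = a + b) (m : M 0) :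
  coact M E (coinv_proj phi c m) = tens (coinv_proj phi a m) aone.
Proof.
have E' : - c = - b + - a by rewrite E opprD addrC.
have E1 : - a = b + - c by rewrite E opprD addrCA subrr addr0.
have E2 : - a = 0 + - a by rewrite add0r.
have E3 := esym (subrr b) : 0 = b + - b.
rewrite /coinv_proj (lin_tlift _ _ (coact_linear (comoduleP M) E)).
transitivity (\tsum_(x, h <- coact M (esym (subrr c)) m)
  \tsum_(x0, x1 <- coact M E x) \tsum_(u, v <- hdelta H E' h)
    tens (pact M (phi (hanti_inv v)) x0) (hanti_inv u ** x1)).
  apply: tlift_ext => x h; rewrite coact_phi_act (delta_hanti_inv hS E E').
  rewrite lin_tlift; last by lin.
  rewrite [RHS]tlift_exchange; apply: tlift_ext => u v.
  by rewrite tlift_tens //; lin.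
rewrite (coact_assoc (F := fun x0 x1 h => \tsum_(u, v <- hdelta H E' h)
    tens (pact M (phi (hanti_inv v)) x0) (hanti_inv u ** x1))
  E (esym (subrr c)) E1 (esym (subrr a))); [|lin..].
rewrite [RHS](lin_tlift _ _ ((tens_bilin _ _).1 _)).
apply: tlift_ext => x0 z.
rewrite -(delta_assoc (F := fun x1 u v =>
    tens (pact M (phi (hanti_inv v)) x0) (hanti_inv u ** x1)) E3 E2 E' E1); [|lin..].
rewrite -(delta_counitl E2
  (f := fun z => tens (pact M (phi (hanti_inv z)) x0) aone)); last by lin.
apply: tlift_ext => w v.
rewrite -(lin_tlift _ _ ((tens_bilin _ _).2 _)) (hanti_inv_mulr hS).
by rewrite (linZ ((tens_bilin _ _).2 _)).
Qed.

(** Here phi(S^-1(x_1 m_1)) = phi(S^-1(m_1)) phi(S^-1(x_1)), and commutativity of A regroups the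
    factors belonging to x and those belonging to m. *)
Lemma coinv_proj_act (M : poissonHopfModule A) a (x : A 0) (m : M 0) :
  coinv_proj phi a (pact M x m)
  = pact M (coinv_proj phi a (x : regular A 0)) (coinv_proj phi a m).
Proof.
have pl := act_bilin (pactP M a).
rewrite /coinv_proj pcoact_act tlift_tmap2; [|lin].
rewrite (lin_tlift _ _ (pl.1 _)); apply: tlift_ext => x0 x1.
rewrite (lin_tlift _ _ (pl.2 _)); apply: tlift_ext => m0 m1 /=.
rewrite -!(actM (pactP M a)) (hanti_invM hS) phiM; congr pact.
by rewrite -!amulA amulC -!amulA; congr (_ ** _); rewrite amulC.
Qed.

(** The left side is the sum of phi(m_2 S^-1(m_1)) . m_0, whose coefficient contracts to the counit
    by [hanti_inv_mull]. *)
Lemma coinv_proj_decomp (M : poissonHopfModule A) a (E : a = 0 + a) (m : M a) :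
  \tsum_(x, h <- coact M E m) pact M (phi h) (coinv_proj phi a x) = m.
Proof.
have E0 : 0 = - a + a by rewrite addNr.
have Ea : a = a + 0 by rewrite addr0.
have pl := act_bilin (pactP M a).
transitivity (\tsum_(x, h <- coact M E m)
    \tsum_(u, v <- coact M (esym (subrr a)) x)
      pact M (phi (h ** hanti_inv v)) u).
  apply: tlift_ext => x h; rewrite (lin_tlift _ _ (pl.2 _)).
  by apply: tlift_ext => u v; rewrite -(actM (pactP M a)) phiM.
rewrite (coact_assoc (F := fun u v h => pact M (phi (h ** hanti_inv v)) u)
  (esym (subrr a)) E E0 Ea); [|lin..].
rewrite -[RHS](coact_counitr Ea (f := id)); last exact: lin_id.
apply: tlift_ext => u y.
rewrite -(lin_tlift (g := fun h => pact M (phi h) u)); last by lin.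
rewrite (hanti_inv_mull hS) (linZ (@phil _)) (linZ (pl.1 _)) phi1.
by rewrite (act1 (pactP M a)).
Qed.

Lemma coinv_coinv_proj (M : poissonHopfModule A) a (m : M 0) :
  coinv (coinv_proj phi a m).
Proof.
by exists (fun c => coinv_proj phi c m) => // c d b E; apply: coact_coinv_proj.
Qed.

Lemma plact_eq0 (M : poissonHopfModule A) a (x : A a) (m : M a) :
  trivial_lie_coinv phi M -> plact M x m = 0.
Proof.
move=> hM; have E : a = 0 + a by rewrite add0r.
have pl := act_bilin (pactP M a).
have projl := @coinv_proj_linear M a.
rewrite -[LHS](coinv_proj_decomp E) pcoact_lact tlift_tmap2; [|lin].
(* Each summand vanishes separately: p(x0 <> m0) is a value of x0 <>' p(m0), with [m0] as the
   preimage required by [diamond']. *)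
apply: big1 => -[x0 x1] _; apply: big1 => -[m0 m1] _ /=.
rewrite (hM x0 a (coinv_proj phi a m0) (coinv_proj phi a (plact M x0 m0))).
- exact: (lin0 (pl.2 _)).
- exact: coinv_coinv_proj.
- by exists m0.
Qed.

(** * A splitting built from coinvariants *)

Section Splitting.
Variables M N : poissonHopfModule A.
Hypotheses (hM : trivial_lie_coinv phi M) (hN : trivial_lie_coinv phi N).
Variable q : forall a, M 0 -> N a.
Hypothesis q_linear : forall a, linear (q a).
Hypothesis q_act : forall a (x : A 0) m,
  q a (pact M x m) = pact N (coinv_proj phi a (x : regular A 0)) (q a m).
Hypothesis q_coinv : forall m, coinv_family (q^~ m).

(** The map [q] stands for the projection p of [M] followed by a section on invariants, viewed in
    the ambient [N a]. *)
Definition splitting a (m : M a) : N a :=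
  \tsum_(x, h <- coact M (esym (add0r a)) m) pact N (phi h) (q a x).

Lemma splitting_linear a : linear (splitting (a := a)).
Proof. by have pl := act_bilin (pactP N a); rewrite /splitting; lin. Qed.

(** Since [q^~ x] is a coinvariant family, the coaction sends q_c(x) to q_a(x) (x) 1 and only phi(h)
    contributes a second leg; coassociativity then moves that leg onto the coaction of [m]. *)
Lemma splitting_colinear : colinear (M := M) (N := N) splitting.
Proof.
move=> c a b E m; have Nl := coact_linear (comoduleP N) E.
rewrite /splitting (lin_tlift _ _ Nl).
transitivity (\tsum_(x, h <- coact M (esym (add0r c)) m)
    \tsum_(u, v <- hdelta H E h) tens (pact N (phi u) (q a x)) v).
  apply: tlift_ext => x h; rewrite coact_phi_act (q_coinv x E).
  apply: tlift_ext => u v; rewrite tlift_tens; [|lin].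
  by rewrite amulx1.
rewrite -(coact_assoc (F := fun x u v => tens (pact N (phi u) (q a x)) v)
  (esym (add0r a)) E E (esym (add0r c))); [|lin..].
by apply: tlift_ext => y v; rewrite -(lin_tlift _ _ ((tens_bilin _ _).1 _)).
Qed.

Lemma splittingP : poisson_hopf_map splitting.
Proof.
split=> [a|a x m|a x m|]; [exact: splitting_linear| | |exact: splitting_colinear].
- have pl := act_bilin (pactP N a).
  (* [q_act] only handles scalars of the form p(x_0), so on the right [x] is expanded in the regular
     module as phi(x_1) p(x_0). *)
  rewrite /splitting -[in RHS](coinv_proj_decomp (M := regular A) (esym (add0r a)) x).
  rewrite pcoact_act tlift_tmap2; [|lin].
  rewrite (lin_tlift _ _ (pl.1 _)); apply: tlift_ext => x0 x1.
  rewrite (lin_tlift _ _ (pl.2 _)); apply: tlift_ext => m0 m1 /=.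
  rewrite q_act -!(actM (pactP N a)) phiM; congr pact.
  by rewrite -!amulA; congr (_ ** _); rewrite amulC.
(* Lie linearity reduces to 0 = 0, because the Lie actions on [M] and [N] both vanish. *)
- rewrite !plact_eq0 //.
  exact: (lin0 (@splitting_linear a)).
Qed.

(** By A-linearity [i] passes under phi(h) and turns q into p, so the sum is the decomposition of
    [m]. *)
Lemma splittingK (i : forall a, N a -> M a) a (m : M a) :
  poisson_hopf_map i ->
  (forall u, i a (q a u) = coinv_proj phi a u) -> i a (splitting m) = m.
Proof.
move=> [il ia _ _] iq; rewrite /splitting (lin_tlift _ _ (il a)).
rewrite -[RHS](coinv_proj_decomp (esym (add0r a)) m).
by apply: tlift_ext => x h; rewrite ia iq.
Qed.
End Splitting.
End Projection.

(** * Lifting along a morphism whose restriction to invariants splits *)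

Theorem corollary3p12 (k : fieldType) (G : zmodType) (H : hopfGcoalgebra k G)
    (hS : bijective_antipode H) (A : comodPoisson H)
    (phi : forall a : G, H a -> A a)
    (hphi : colinear_algebra_map_center phi)
    (hM : forall M : poissonHopfModule A, trivial_lie_coinv phi M)
    (hA : trivial_lie_coinv phi (regular A)) :
  dual_maschke (F1 A).
Proof.
move=> P C D i [j ij] f.
(* The section [j] is defined only on M^{AcoH}; the projection lands there because its values are
   coinvariant and every Lie action is zero. *)
have pS (M : poissonHopfModule A) a u :
    lie_coinv_space M a (coinv_proj phi a u).
  split; first exact: (coinv_coinv_proj hS hphi).
  by move=> x; apply: (plact_eq0 hS hphi).
have [jl ja jc] := svalP j.
pose p a u : F1_obj D a := sub_in (pS D a u).
have pl a : linear (p a).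
  move=> c x y; apply: sub_val_inj; rewrite sub_val_linear !sub_inK.
  exact: (coinv_proj_linear hS hphi).
pose q a u : C a := sub_val (sval j a (p a u)).
have ql a : linear (q a).
  by move=> c x y; rewrite /q pl jl sub_val_linear.
have qa a (x : A 0) m :
    q a (pact D x m) = pact C (coinv_proj phi a (x : regular A 0)) (q a m).
  (* By [pS] for the regular module, p(x) is an element of B, so p(x . m) = p(x) . p(m) reduces the
     claim to B-linearity of [j]. *)
  pose b : coinv_alg A a := sub_in (pS (regular A) a x).
  have -> : q a (pact D x m) = sub_val (sval j a (tact b (p a m))).
    congr (sub_val (sval j a _)); apply: sub_val_inj.
    exact: (coinv_proj_act hS hphi).
  by rewrite ja.
(* Colinearity of [j] transports the coinvariant family of the p_a(u). Coinvariance inside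
   [F1_obj D] is checked in [D], as the inclusion remains injective after tensoring with H. *)
have qc u : coinv_family (fun a => q a u).
  move=> c a b E; rewrite /q -restr_coactE.
  have -> : restr_coact E (sval j c (p c u)) = tens (sval j a (p a u)) aone.
    rewrite -[LHS]/(coact (F1_obj C) E (sval j c (p c u))) jc.
    have -> : coact (F1_obj D) E (p c u) = tens (p a u) aone.
      apply: tmap_sub_inj; rewrite restr_coactE.
      rewrite tmap_tens; [|exact: sub_val_linear|exact: lin_id].
      exact: (coact_coinv_proj hS hphi).
    by rewrite tmap_tens; [|exact: jl|exact: lin_id].
  by rewrite tmap_tens; [|exact: sub_val_linear|exact: lin_id].
have iq a u : sval i a (q a u) = coinv_proj phi a u.
  (* The splitting equation is evaluated at [p a u] and read in [D a]. *)
  have := congr1 (fun g : triv_hom (F1_obj D) (F1_obj D) =>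
    sub_val (sval g a (p a u))) ij.
  by [].
(* Since the splitting is a section of [i] in the category itself, its composite with [f] is a lift
   of [f]. *)
exists (phm_comp (exist _ _ (splittingP hS hphi (hM D) (hM C) ql qa qc)) f).
apply: hom_eq => a x /=.
exact: (splittingK hS hphi _ (svalP i) (iq a)).
Qed.
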